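(* Let $m,n$ be positive integers satisfying $m\geq n\geq 1$ and $m+n\equiv 0\pmod 2$. Then \[ \int_0^\infty \frac{\tanh^m x}{x^n\cosh x}\,dx = (-1)^{(m-n)/2} \sum_{p=\lceil n/2\rceil}^{(m+n)/2} 2^{2p}\binom{2p-1}{n-1}\frac{\beta(2p)}{\pi^{2p-1}}\, [u^{m+n-2p}]\,\frac{u}{\sin u}(u\cot u)^m . \]
   Context: $\beta(s)=\sum_{j=0}^\infty \frac{(-1)^j}{(2j+1)^s}$ is the Dirichlet beta function. For a power series or Laurent series $F$, $[u^r]F(u)$ denotes the coefficient of $u^r$ in the expansion of $F$ at the origin. The functions $u/\sin u$ and $u\cot u$ are extended analytically to $u=0$ with value $1$. *)

(* Defs.v *)
From Stdlib Require Import Reals Lra ClassicalEpsilon.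
From Coquelicot Require Import Coquelicot.
Open Scope R_scope.

(* Restricted to real s.  [Series] is the limit of the partial sums in the
   order of j, so the value is the right one also for 0 < s <= 1, where the
   convergence is only conditional. *)
Definition dirichlet_beta (s : R) : R :=
  Series (fun j : nat => (-1) ^ j / Rpower (2 * INR j + 1) s).

Definition has_expansion (F : R -> R) (a : nat -> R) : Prop :=
  locally 0 (fun u : R => is_pseries a u (F u)).

(* [u^r] F(u).  The choice is harmless: the sequence of coefficients is unique
   (see [coeff_expansion]).  The value is unspecified when F is not analytic
   at the origin. *)
Definition coeff (r : nat) (F : R -> R) : R :=
  epsilon (inhabits (fun _ : nat => 0)) (has_expansion F) r.

Definition u_over_sin (u : R) : R :=
  if Req_EM_T u 0 then 1 else u / sin u.

Definition u_cot (u : R) : R :=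
  if Req_EM_T u 0 then 1 else u * (cos u / sin u).

Lemma has_expansion_radius (F : R -> R) (a : nat -> R) :
  has_expansion F a -> Rbar_lt 0 (CV_radius a).
Proof.
intros [e He].
assert (He0 := cond_pos e).
assert (Hb : ball 0 e (e / 2)).
{ change (Rabs (e / 2 - 0) < e).
  rewrite Rminus_0_r, Rabs_pos_eq; lra. }
apply Rbar_lt_le_trans with (Finite (Rabs (e / 2))).
{ simpl. rewrite Rabs_pos_eq; lra. }
apply Rbar_not_lt_le; intros Hlt.
apply (CV_disk_outside a (e / 2) Hlt).
apply ex_series_lim_0.
exists (F (e / 2)).
apply is_pseries_R, He, Hb.
Qed.

Lemma has_expansion_unique (F : R -> R) (a b : nat -> R) :
  has_expansion F a -> has_expansion F b -> forall r : nat, a r = b r.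
Proof.
intros Ha Hb r.
apply PSeries_ext_recip.
- exact (has_expansion_radius F a Ha).
- exact (has_expansion_radius F b Hb).
- generalize (filter_and _ _ Ha Hb).
  apply filter_imp; intros u [Hau Hbu].
  rewrite (is_pseries_unique _ _ _ Hau).
  now rewrite (is_pseries_unique _ _ _ Hbu).
Qed.

Lemma coeff_expansion (F : R -> R) (a : nat -> R) (r : nat) :
  has_expansion F a -> coeff r F = a r.
Proof.
intros Ha.
apply (has_expansion_unique F); [|exact Ha].
apply epsilon_spec; now exists a.
Qed.

(* Main.v *)
(* Let f_m = tanh^m / cosh and let I(m,n) be the integral over (0, oo) of
   (f_m - its Taylor polynomial of degree < n) / x^n; for m >= n the polynomial
   vanishes and I(m,n) is the integral to be computed.  Since
   f_m' = m f_(m-1) - (m+1) f_(m+1), integration by parts gives, for m + n odd,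
     (m+1) I(m+1,n) = m I(m-1,n) - n I(m,n+1),
   which determines I from the values I(0,2p).  The right-hand side obeys the
   same recursion, because csc cot^m has derivative
   - m csc cot^(m-1) - (m+1) csc cot^(m+1).  Finally, I(0,2p) comes from the
   expansion of 1/cosh into the partial fractions 2 (-1)^k a / (a^2 + x^2) with
   a = (k + 1/2) pi: subtracting the Taylor polynomial and dividing by x^(2p)
   multiplies each fraction by (-1)^p / a^(2p), and the integral of the result is
   (-1)^p pi / a^(2p) up to the sign (-1)^k. *)

Require Import Defs.
From Stdlib Require Import Reals Lra Lia Arith.
From Coquelicot Require Import Coquelicot.
Open Scope R_scope.

(** * Power series expansions at 0 *)

(* [ring] and [field] do not see through Coquelicot's structures on R. *)
Ltac eqR := match goal with |- @eq _ ?x ?y => change (@eq R x y) end.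

(** The recursion leaves the region m >= n on its way to m = 0, where 1 / (x^n cosh x) is not
    integrable at the origin; hence Taylor remainders are integrated throughout. That m + n is odd
    in an integration by parts matters twice: the coefficient of x^n in f_m vanishes, which kills
    the boundary term at 0 and makes the derivative of a remainder a combination of remainders. On
    the other side, differentiating u^(m+1) csc u cot^m u produces at u^r a factor m + 1 - r, which
    equals 2p - n, the factor between consecutive binomial coefficients. For p >= 1 the partial
    fractions divided by a^(2p) alternate in sign and decrease in size, so the tail is at most the
    last term kept, which is bounded independently of x. This uniformity carries the limit through
    the integral and to both endpoints. No general formula for Taylor coefficients is used:
    expansions are shown to exist, and identities between functions pass to coefficients by
    uniqueness. *)

Lemma locally_lt_radius (r : Rbar) :
  Rbar_lt 0 r -> locally 0 (fun u : R => Rbar_lt (Rabs u) r).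
Proof.
intros Hr.
destruct (Rbar_lt_locally m_infty r 0 I Hr) as [d Hd].
destruct r as [r| |]; simpl in *; try easy.
- exists (mkposreal r Hr); intros u Hu.
  change (Rabs (u - 0) < r) in Hu. now rewrite Rminus_0_r in Hu.
- now exists (mkposreal 1 Rlt_0_1).
Qed.

Lemma has_expansion_PSeries (a : nat -> R) :
  Rbar_lt 0 (CV_radius a) -> has_expansion (PSeries a) a.
Proof.
intros Ha.
generalize (locally_lt_radius _ Ha); unfold has_expansion; apply filter_imp; intros u Hu.
apply PSeries_correct, CV_radius_inside, Hu.
Qed.

Lemma has_expansion_forall (F : R -> R) (a : nat -> R) :
  (forall u, is_pseries a u (F u)) -> has_expansion F a.
Proof. exact (filter_forall _). Qed.

Lemma has_expansion_eq (F : R -> R) (a : nat -> R) :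
  has_expansion F a -> locally 0 (fun u => F u = PSeries a u).
Proof.
unfold has_expansion; apply filter_imp; intros u Hu.
now rewrite (is_pseries_unique _ _ _ Hu).
Qed.

Lemma has_expansion_ext (F G : R -> R) (a : nat -> R) :
  locally 0 (fun u => F u = G u) -> has_expansion F a -> has_expansion G a.
Proof.
intros HFG HF; generalize (filter_and _ _ HFG HF).
unfold has_expansion; apply filter_imp; intros u [E Hu]; now rewrite <- E.
Qed.

Lemma has_expansion_at_0 (F : R -> R) (a : nat -> R) :
  has_expansion F a -> a 0%nat = F 0.
Proof.
intros HF. rewrite <- (PSeries_0 a).
apply is_pseries_unique, (locally_singleton _ _ HF).
Qed.

Lemma has_expansion_plus (F G : R -> R) (a b : nat -> R) :
  has_expansion F a -> has_expansion G b ->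
  has_expansion (fun u => F u + G u) (PS_plus a b).
Proof.
intros HF HG; generalize (filter_and _ _ HF HG).
unfold has_expansion; apply filter_imp; intros u [Hu Hv].
exact (is_pseries_plus _ _ _ _ _ Hu Hv).
Qed.

Lemma has_expansion_scal (c : R) (F : R -> R) (a : nat -> R) :
  has_expansion F a -> has_expansion (fun u => c * F u) (PS_scal c a).
Proof.
unfold has_expansion; apply filter_imp; intros u Hu.
apply (is_pseries_scal c a u (F u)); [apply Rmult_comm | exact Hu].
Qed.

Lemma has_expansion_incr_1 (F : R -> R) (a : nat -> R) :
  has_expansion F a -> has_expansion (fun u => u * F u) (PS_incr_1 a).
Proof.
unfold has_expansion; apply filter_imp; intros u Hu.
exact (is_pseries_incr_1 a u (F u) Hu).
Qed.

Lemma has_expansion_mult (F G : R -> R) (a b : nat -> R) :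
  has_expansion F a -> has_expansion G b ->
  has_expansion (fun u => F u * G u) (PS_mult a b).
Proof.
intros HF HG.
generalize (filter_and _ _ (filter_and _ _ HF HG)
  (filter_and _ _ (locally_lt_radius _ (has_expansion_radius _ _ HF))
     (locally_lt_radius _ (has_expansion_radius _ _ HG)))).
unfold has_expansion; apply filter_imp; intros u [[Hu Hv] [Ra Rb]].
now apply is_pseries_mult.
Qed.

Lemma has_expansion_1 :
  has_expansion (fun _ => 1) (fun n => match n with O => 1 | S _ => 0 end).
Proof.
exists (mkposreal 1 Rlt_0_1); intros u _.
apply is_pseries_R, is_series_Reals; intros e He; exists O; intros n _.
replace (sum_f_R0 _ n) with 1; [now rewrite Rdist_eq|].
induction n as [|n IH]; simpl; [ring|]; rewrite <- IH; ring.
Qed.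

Lemma has_expansion_pow (F : R -> R) (a : nat -> R) (m : nat) :
  has_expansion F a -> exists b, has_expansion (fun u => F u ^ m) b.
Proof.
intros HF; induction m as [|m [b Hb]].
- eexists; exact has_expansion_1.
- eexists; exact (has_expansion_mult _ _ _ _ HF Hb).
Qed.

Lemma has_expansion_comp_opp (F : R -> R) (a : nat -> R) :
  has_expansion F a ->
  has_expansion (fun u => F (- u)) (fun n => (-1) ^ n * a n).
Proof.
intros [e He]; exists e; intros u Hu.
apply is_pseries_R.
apply is_series_ext with (fun n => a n * (- u) ^ n).
- intros n; replace (- u) with (-1 * u) by ring.
  rewrite Rpow_mult_distr; eqR; ring.
- apply is_pseries_R, He.
  change (Rabs (- u - 0) < e); change (Rabs (u - 0) < e) in Hu.
  now rewrite Rminus_0_r, Rabs_Ropp, <- (Rminus_0_r u).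
Qed.

Lemma has_expansion_is_derive (F : R -> R) (a : nat -> R) :
  has_expansion F a ->
  locally 0 (fun u => is_derive F u (PSeries (PS_derive a) u)).
Proof.
intros HF.
generalize (filter_and _ _ (locally_lt_radius _ (has_expansion_radius _ _ HF))
  (locally_locally _ _ (has_expansion_eq _ _ HF))).
apply filter_imp; intros u [Hu HE].
apply is_derive_ext_loc with (PSeries a).
- revert HE; apply filter_imp; intros v Hv; now symmetry.
- now apply is_derive_PSeries.
Qed.

Lemma has_expansion_derive (F G : R -> R) (a : nat -> R) :
  has_expansion F a -> locally 0 (fun u => is_derive F u (G u)) ->
  has_expansion G (PS_derive a).
Proof.
intros HF HG.
apply has_expansion_ext with (PSeries (PS_derive a)).
- generalize (filter_and _ _ (has_expansion_is_derive _ _ HF) HG).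
  apply filter_imp; intros u [H1 H2].
  now rewrite <- (is_derive_unique _ _ _ H1), (is_derive_unique _ _ _ H2).
- apply has_expansion_PSeries; rewrite CV_radius_derive.
  exact (has_expansion_radius _ _ HF).
Qed.

(** * Reciprocal of a power series with constant term 1 *)

Fixpoint inv_coeffs (a : nat -> R) (n : nat) : nat -> R :=
  match n with
  | O => fun _ => 1
  | S n => fun k =>
      if Nat.leb k n then inv_coeffs a n k
      else - sum_f_R0 (fun i => inv_coeffs a n i * a (S n - i)%nat) n
  end.

(** The Cauchy product forces [b (n+1) = - sum b i * a (n+1-i)] when [a 0 = 1]. This needs all
    earlier values, so stage [n] of [inv_coeffs] is a table, meaningful up to index [n] only, and
    the coefficient is read on the diagonal. *)
Definition inv_coeff (a : nat -> R) (n : nat) : R := inv_coeffs a n n.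

Lemma inv_coeffs_stable (a : nat -> R) (n k : nat) :
  (k <= n)%nat -> inv_coeffs a n k = inv_coeff a k.
Proof.
induction n as [|n IH]; intros Hk.
- now replace k with O by lia.
- destruct (Nat.eq_dec k (S n)) as [->|Hn]; [easy|].
  simpl; destruct (Nat.leb_spec k n); [now apply IH | lia].
Qed.

Lemma inv_coeff_S (a : nat -> R) (n : nat) :
  inv_coeff a (S n) =
  - sum_f_R0 (fun i => inv_coeff a i * a (S n - i)%nat) n.
Proof.
unfold inv_coeff at 1; cbn [inv_coeffs].
destruct (Nat.leb_spec (S n) n); [lia|].
f_equal; apply sum_eq; intros i Hi; now rewrite inv_coeffs_stable.
Qed.

(** By induction the sum is at most [M ^ (n+1)] times 1 + 2 + ... + 2^n, which is below 2^(n+1). *)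
Lemma inv_coeff_bound (a : nat -> R) (M : R) :
  0 <= M -> (forall k, (1 <= k)%nat -> Rabs (a k) <= M ^ k) ->
  forall n, Rabs (inv_coeff a n) <= (2 * M) ^ n.
Proof.
intros HM Ha n; induction n as [n IH] using (well_founded_induction lt_wf).
destruct n as [|n]; [unfold inv_coeff; simpl; rewrite Rabs_R1; lra|].
rewrite inv_coeff_S, Rabs_Ropp.
apply Rle_trans with (sum_f_R0 (fun i => 2 ^ i * M ^ S n) n).
- apply Rle_trans with (1 := Rsum_abs _ _).
  apply sum_Rle; intros i Hi; rewrite Rabs_mult.
  replace (2 ^ i * M ^ S n) with ((2 * M) ^ i * M ^ (S n - i)).
  + apply Rmult_le_compat; try apply Rabs_pos.
    * apply IH; lia.
    * apply Ha; lia.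
  + rewrite Rpow_mult_distr, Rmult_assoc, <- pow_add.
    do 2 f_equal; lia.
- rewrite <- scal_sum, tech3 by lra.
  rewrite Rpow_mult_distr.
  assert (0 <= M ^ S n) by now apply pow_le.
  replace ((1 - 2 ^ S n) / (1 - 2)) with (2 ^ S n - 1) by field.
  nra.
Qed.

(** A geometric bound on the coefficients of F gives one for the recursive coefficients, hence a
    positive radius. The product of the two series is then the constant 1, which also shows that F
    does not vanish near 0. *)
Lemma has_expansion_inv (F : R -> R) (a : nat -> R) :
  has_expansion F a -> F 0 = 1 -> exists b, has_expansion (fun u => / F u) b.
Proof.
intros HF H0.
assert (Ha0 := has_expansion_at_0 _ _ HF); rewrite H0 in Ha0.
assert (Hrad := has_expansion_radius _ _ HF).
assert (HM : exists M, 0 < M /\ forall k, (1 <= k)%nat -> Rabs (a k) <= M ^ k).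
{ destruct (locally_lt_radius _ Hrad) as [e He].
  assert (Hr : 0 < e / 2) by (generalize (cond_pos e); lra).
  assert (Hball : ball 0 e (e / 2)).
  { change (Rabs (e / 2 - 0) < e). rewrite Rminus_0_r, Rabs_pos_eq; lra. }
  assert (Hs := CV_disk_inside _ _ (He _ Hball)).
  apply ex_series_lim_0 in Hs.
  assert (Hb : exists C, forall n, Rabs (a n * (e / 2) ^ n) <= C).
  { destruct (filterlim_bounded (K := R_AbsRing) (V := R_NormedModule)
      (fun n => Rabs (a n * (e / 2) ^ n))) as [C HC].
    - now exists 0.
    - exists C; intros n; generalize (HC n).
      change (norm (Rabs (a n * (e / 2) ^ n))) with
        (Rabs (Rabs (a n * (e / 2) ^ n))).
      now rewrite Rabs_Rabsolu. }
  destruct Hb as [C HC].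
  (* A constant at least 1 satisfies [D <= D ^ k] for [k >= 1] and can be absorbed into the base
     M. *)
  set (D := Rmax C 1).
  assert (HD : 1 <= D) by apply Rmax_r.
  exists (D / (e / 2)); split; [apply Rdiv_lt_0_compat; lra|].
  intros k Hk.
  unfold Rdiv at 1; rewrite Rpow_mult_distr, pow_inv.
  assert (Hp : 0 < (e / 2) ^ k) by now apply pow_lt.
  apply (Rmult_le_reg_r ((e / 2) ^ k)); [easy|].
  rewrite Rmult_assoc, Rinv_l, Rmult_1_r by lra.
  rewrite <- (Rabs_pos_eq ((e / 2) ^ k)) by lra.
  rewrite <- Rabs_mult.
  apply Rle_trans with (1 := HC k).
  apply Rle_trans with D; [apply Rmax_l|].
  rewrite <- (pow_1 D) at 1; now apply Rle_pow. }
destruct HM as [M [HM Ha]].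
assert (Hb := inv_coeff_bound a M (Rlt_le _ _ HM) Ha).
assert (Rb : Rbar_lt 0 (CV_radius (inv_coeff a))).
{ apply Rbar_lt_le_trans with (Finite (/ (2 * M))).
  - apply Rinv_0_lt_compat; lra.
  - apply CV_radius_bounded; exists 1; intros n.
    assert (Hp : 0 < (2 * M) ^ n) by (apply pow_lt; lra).
    rewrite Rabs_mult, pow_inv, (Rabs_pos_eq (/ _))
      by (apply Rlt_le, Rinv_0_lt_compat; easy).
    apply (Rmult_le_reg_r ((2 * M) ^ n)); [easy|].
    rewrite Rmult_assoc, Rinv_l, Rmult_1_l, Rmult_1_r by lra; apply Hb. }
exists (inv_coeff a).
apply has_expansion_ext with (PSeries (inv_coeff a));
  [|now apply has_expansion_PSeries].
assert (Hm := has_expansion_mult _ _ _ _ (has_expansion_PSeries _ Rb) HF).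
assert (Hm1 := has_expansion_eq _ _ has_expansion_1).
generalize (filter_and _ _ (has_expansion_eq _ _ Hm) Hm1).
apply filter_imp; intros u [E1 E2].
rewrite (PSeries_ext (PS_mult (inv_coeff a) a)
  (fun n => match n with O => 1 | S _ => 0 end)) in E1.
- rewrite <- E2 in E1; assert (Z : F u <> 0) by (intros Z; rewrite Z in E1; lra).
  apply (Rmult_eq_reg_r (F u)); [|easy]; rewrite Rinv_l by easy; lra.
- intros [|n]; unfold PS_mult; simpl sum_f_R0.
  + rewrite Ha0; unfold inv_coeff; simpl; ring.
  + rewrite Nat.sub_diag, Ha0, inv_coeff_S; ring_simplify.
    apply Rminus_diag_eq, sum_eq; intros i Hi; destruct i; reflexivity.
Qed.

(** Comparing coefficients gives [(-1)^n a n = (-1)^e a n], and the two signs differ. *)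
Lemma has_expansion_odd_vanish (F : R -> R) (a : nat -> R) (e : nat) :
  has_expansion F a -> (forall u, F (- u) = (-1) ^ e * F u) ->
  forall n, Nat.Odd (n + e) -> a n = 0.
Proof.
intros HF Hpar n [q Hq].
assert (H := has_expansion_unique _ _ _
  (has_expansion_ext _ _ _ (filter_forall _ Hpar)
     (has_expansion_comp_opp _ _ HF)) (has_expansion_scal ((-1) ^ e) _ _ HF) n).
unfold PS_scal, scal in H; simpl in H; unfold mult in H; simpl in H.
assert (Hs : (-1) ^ n * (-1) ^ e = -1).
{ rewrite <- pow_add, Hq, pow_add, pow_1, pow_1_even; ring. }
assert (He : (-1) ^ e * (-1) ^ e = 1).
{ rewrite <- pow_add; replace (e + e)%nat with (2 * e)%nat by lia.
  apply pow_1_even. }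
assert (H2 : (-1) ^ e * ((-1) ^ n * a n) = (-1) ^ e * ((-1) ^ e * a n))
  by now rewrite H.
rewrite <- 2!Rmult_assoc, He, (Rmult_comm ((-1) ^ e)), Hs in H2.
lra.
Qed.

(** * Taylor polynomials and their remainders *)

Fixpoint trunc (a : nat -> R) (n : nat) (x : R) : R :=
  match n with
  | O => 0
  | S n => trunc a n x + a n * x ^ n
  end.

Lemma trunc_0 (a : nat -> R) (n : nat) (x : R) :
  (forall i, (i < n)%nat -> a i = 0) -> trunc a n x = 0.
Proof.
induction n as [|n IH]; intros Ha; [easy|]; simpl.
rewrite IH, (Ha n) by (intros; try apply Ha; lia); ring.
Qed.

Lemma is_derive_trunc (a : nat -> R) (n : nat) (x : R) :
  is_derive (trunc a (S n)) x (trunc (PS_derive a) n x).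
Proof.
induction n as [|n IH].
- apply is_derive_ext with (fun _ => a O); [|auto_derive; easy].
  intros t; simpl; eqR; ring.
- apply (is_derive_plus (trunc a (S n)) (fun x => a (S n) * x ^ S n)); [easy|].
  auto_derive; [easy|]; unfold PS_derive; rewrite Rmult_1_l, S_INR; simpl pred; eqR.
  destruct n; simpl INR; ring.
Qed.

Lemma continuous_trunc (a : nat -> R) (n : nat) (x : R) :
  continuous (trunc a n) x.
Proof.
induction n as [|n IH]; [apply continuous_const|].
apply (continuous_plus (trunc a n) (fun x => a n * x ^ n)); [easy|].
apply (ex_derive_continuous (fun x => a n * x ^ n)); auto_derive; easy.
Qed.

Lemma trunc_lim_p_infty (a : nat -> R) (n : nat) :
  filterlim (fun x => trunc a n x / x ^ n) (Rbar_locally p_infty) (locally 0).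
Proof.
induction n as [|n IH].
- apply filterlim_ext with (fun _ => 0); [intros x; simpl; field|].
  apply filterlim_const.
- apply filterlim_ext_loc with (fun x => (trunc a n x / x ^ n + a n) * / x).
  + exists 0; intros x Hx; simpl; assert (x ^ n <> 0) by (apply pow_nonzero; lra).
    field; split; [easy|lra].
  + change (is_lim (fun x => (trunc a n x / x ^ n + a n) * / x) p_infty 0).
    replace (Finite 0) with (Rbar_mult (0 + a n) 0) by (simpl; f_equal; ring).
    apply is_lim_mult; [| |easy].
    * apply (is_lim_plus _ _ _ 0 (a n)); [exact IH| apply is_lim_const | easy].
    * apply (is_lim_inv (fun x => x) p_infty p_infty); [apply is_lim_id|easy].
Qed.

(** Near 0 the remainder is [x ^ n] times the series shifted by [n], which is continuous with value
    [a n] at 0. *)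
Lemma trunc_lim_0 (F : R -> R) (a : nat -> R) (n : nat) :
  has_expansion F a ->
  filterlim (fun x => (F x - trunc a n x) / x ^ n) (at_right 0) (locally (a n)).
Proof.
intros HF.
assert (Hrad := has_expansion_radius _ _ HF).
assert (R' : forall k, CV_radius (PS_decr_n a k) = CV_radius a).
{ induction k as [|k IH]; [now apply CV_radius_ext|].
  rewrite <- IH, <- (CV_radius_decr_1 (PS_decr_n a k)).
  apply CV_radius_ext; intros i; unfold PS_decr_1, PS_decr_n; f_equal; lia. }
assert (E : locally 0 (fun x => F x - trunc a n x =
                                x ^ n * PSeries (PS_decr_n a n) x)).
{ generalize (filter_and _ _ (has_expansion_eq _ _ HF)
    (locally_lt_radius _ Hrad)).
  apply filter_imp; intros x [-> Hx].
  induction n as [|n IH].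
  - simpl; rewrite Rmult_1_l, Rminus_0_r; now apply PSeries_ext.
  - simpl trunc.
    replace (PSeries a x - (trunc a n x + a n * x ^ n)) with
      (PSeries a x - trunc a n x - a n * x ^ n) by ring.
    rewrite IH, PSeries_decr_1
      by (apply CV_radius_inside; now rewrite R').
    unfold PS_decr_n at 1; rewrite Nat.add_0_r.
    rewrite (PSeries_ext (PS_decr_1 (PS_decr_n a n)) (PS_decr_n a (S n))).
    + simpl; ring.
    + intros i; unfold PS_decr_1, PS_decr_n; f_equal; lia. }
apply filterlim_ext_loc with (PSeries (PS_decr_n a n)).
- destruct E as [d Hd]; exists d; intros x Hx Hpos.
  rewrite Hd by easy; field; apply pow_nonzero; lra.
- apply (filterlim_filter_le_1 (F := locally 0));
    [apply filter_le_within; apply locally_filter|].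
  replace (a n) with (PSeries (PS_decr_n a n) 0).
  + apply continuity_pt_filterlim, PSeries_continuity.
    now rewrite R', Rabs_R0.
  + rewrite PSeries_0; unfold PS_decr_n; now rewrite Nat.add_0_r.
Qed.

(** * Coefficients of tanh^m / cosh and of csc cot^m *)

(** Passes from the mere existence of an expansion to a statement about [coeff], so that witnesses
    can stay anonymous. *)
Lemma has_expansion_coeff (F : R -> R) (a : nat -> R) :
  has_expansion F a -> has_expansion F (fun r => coeff r F).
Proof.
intros HF; apply (ClassicalEpsilon.epsilon_spec
  (inhabits (fun _ : nat => 0)) (has_expansion F)); now exists a.
Qed.

Definition sech_tanh (m : nat) (x : R) : R := tanh x ^ m / cosh x.

Lemma cosh_gt_0 (x : R) : 0 < cosh x.
Proof. unfold cosh; generalize (exp_pos x) (exp_pos (- x)); lra. Qed.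

Lemma is_derive_cosh (x : R) : is_derive cosh x (sinh x).
Proof. apply is_derive_Reals, derivable_pt_lim_cosh. Qed.

Lemma is_derive_sinh (x : R) : is_derive sinh x (cosh x).
Proof. apply is_derive_Reals, derivable_pt_lim_sinh. Qed.

Lemma cosh_sqr (x : R) : cosh x ^ 2 = 1 + sinh x ^ 2.
Proof.
unfold cosh, sinh.
replace (((exp x + exp (- x)) / 2) ^ 2) with
  (exp x * exp (- x) + ((exp x - exp (- x)) / 2) ^ 2) by field.
now rewrite <- exp_plus, Rplus_opp_r, exp_0.
Qed.

Lemma is_derive_tanh (x : R) : is_derive tanh x (1 - tanh x ^ 2).
Proof.
assert (Hc := cosh_gt_0 x).
evar_last.
- apply (is_derive_div sinh cosh);
    [apply is_derive_sinh | apply is_derive_cosh | lra].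
- unfold tanh; eqR; field; lra.
Qed.

(** At [m = 0] the truncated [pred m] is harmless because its factor is 0. *)
Lemma is_derive_sech_tanh (m : nat) (x : R) :
  is_derive (sech_tanh m) x
    (INR m * sech_tanh (pred m) x - INR (S m) * sech_tanh (S m) x).
Proof.
assert (Hc := cosh_gt_0 x).
evar_last.
- apply (is_derive_div (fun x => tanh x ^ m) cosh); [|apply is_derive_cosh|lra].
  apply (is_derive_pow tanh), is_derive_tanh.
- unfold sech_tanh; eqR.
  replace (sinh x) with (tanh x * cosh x) by (unfold tanh; field; lra).
  rewrite S_INR; destruct m as [|m]; simpl; field; lra.
Qed.

Lemma sech_tanh_opp (m : nat) (x : R) :
  sech_tanh m (- x) = (-1) ^ m * sech_tanh m x.
Proof.
assert (Hc := cosh_gt_0 x).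
assert (Ec : cosh (- x) = cosh x) by (unfold cosh; rewrite Ropp_involutive; lra).
assert (Et : tanh (- x) = -1 * tanh x).
{ unfold tanh; rewrite Ec.
  replace (sinh (- x)) with (- sinh x)
    by (unfold sinh; rewrite Ropp_involutive; lra).
  field; lra. }
unfold sech_tanh; rewrite Et, Ec, Rpow_mult_distr; field; lra.
Qed.

Lemma has_expansion_sech_and_tanh :
  exists s t, has_expansion (fun x => / cosh x) s /\ has_expansion tanh t.
Proof.
assert (He : has_expansion exp (fun n => / INR (fact n)))
  by (apply has_expansion_forall; intros u; apply is_exp_Reals).
assert (Hn := has_expansion_comp_opp _ _ He).
assert (Hc : has_expansion cosh (PS_scal (/ 2) (PS_plus (fun n => / INR (fact n))
  (fun n => (-1) ^ n * / INR (fact n))))).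
{ eapply has_expansion_ext;
    [|exact (has_expansion_scal (/ 2) _ _ (has_expansion_plus _ _ _ _ He Hn))].
  apply filter_forall; intros u; unfold cosh; eqR; field. }
assert (H0 : cosh 0 = 1) by (unfold cosh; rewrite Ropp_0, exp_0; field).
destruct (has_expansion_inv _ _ Hc H0) as [s Hs].
assert (Hsh := has_expansion_derive _ _ _ Hc
  (filter_forall _ (fun u => is_derive_cosh u))).
eexists s, _; split; [exact Hs|].
exact (has_expansion_mult _ _ _ _ Hsh Hs).
Qed.

Lemma sech_tanh_expansion (m : nat) :
  has_expansion (sech_tanh m) (fun r => coeff r (sech_tanh m)).
Proof.
destruct has_expansion_sech_and_tanh as [s [t [Hs Ht]]].
destruct (has_expansion_pow _ _ m Ht) as [b Hb].
eapply has_expansion_coeff; exact (has_expansion_mult _ _ _ _ Hb Hs).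
Qed.

(** tanh has no constant term, so each further factor raises the order by one. *)
Lemma coeff_sech_tanh_low (m i : nat) :
  (i < m)%nat -> coeff i (sech_tanh m) = 0.
Proof.
destruct has_expansion_sech_and_tanh as [_ [t [_ Ht]]].
assert (Ht0 : t O = 0).
{ rewrite (has_expansion_at_0 _ _ Ht); unfold tanh, sinh.
  rewrite Ropp_0; unfold Rdiv; ring. }
revert i; induction m as [|m IH]; intros i Hi; [lia|].
rewrite (coeff_expansion _ (PS_mult t (fun r => coeff r (sech_tanh m)))).
- unfold PS_mult; apply sum_eq_R0; intros [|k] Hk; [rewrite Ht0; ring|].
  rewrite IH by lia; ring.
- eapply has_expansion_ext;
    [|exact (has_expansion_mult _ _ _ _ Ht (sech_tanh_expansion m))].
  apply filter_forall; intros u; unfold sech_tanh; simpl; unfold Rdiv; eqR; ring.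
Qed.

Lemma coeff_sech_tanh_parity (m i : nat) :
  Nat.Odd (i + m) -> coeff i (sech_tanh m) = 0.
Proof.
exact (has_expansion_odd_vanish _ _ m (sech_tanh_expansion m)
  (sech_tanh_opp m) i).
Qed.

Lemma coeff_sech_tanh_derive (m i : nat) :
  INR (S i) * coeff (S i) (sech_tanh m) =
  INR m * coeff i (sech_tanh (pred m)) - INR (S m) * coeff i (sech_tanh (S m)).
Proof.
assert (Hp := has_expansion_plus _ _ _ _
  (has_expansion_scal (INR m) _ _ (sech_tanh_expansion (pred m)))
  (has_expansion_scal (- INR (S m)) _ _ (sech_tanh_expansion (S m)))).
assert (Hd : has_expansion (fun u => INR m * sech_tanh (pred m) u +
   - INR (S m) * sech_tanh (S m) u) (PS_derive (fun r => coeff r (sech_tanh m)))).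
{ apply (has_expansion_derive (sech_tanh m)); [apply sech_tanh_expansion|].
  apply filter_forall; intros u.
  replace (_ + _) with (INR m * sech_tanh (pred m) u -
    INR (S m) * sech_tanh (S m) u) by ring.
  apply is_derive_sech_tanh. }
transitivity (INR m * coeff i (sech_tanh (pred m)) +
   - INR (S m) * coeff i (sech_tanh (S m))); [|ring].
exact (has_expansion_unique _ _ _ Hd Hp i).
Qed.

(** * Expansions of u / sin u, u cot u and their products *)

Lemma sinc_expansion :
  exists a, has_expansion (fun u => if Req_EM_T u 0 then 1 else sin u / u) a.
Proof.
(* The library defines sin u as u times a power series in u^2; that series supplies the even
   coefficients. *)
exists (fun n => if Nat.even n then sin_n (Nat.div2 n) else 0).
apply has_expansion_forall; intros u.
assert (H : exists l, sin_in (Rsqr u) l /\ sin u = u * l)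
  by (unfold sin; destruct (exist_sin (Rsqr u)) as [l Hl]; now exists l).
destruct H as [l [Hl El]].
(* Even part plus u times a zero odd part. At [u = 0] the value 1 has to be read off the series,
   since [sin u = u * l] says nothing about [l] there. *)
replace (if Req_EM_T u 0 then 1 else sin u / u) with (l + u * 0).
2:{ destruct (Req_EM_T u 0) as [->|Hu].
  - assert (Hl0 : infinite_sum (fun n => sin_n n * 0 ^ n) l)
      by now rewrite Rsqr_0 in Hl.
    rewrite Rmult_0_l, Rplus_0_r.
    apply (uniqueness_sum _ _ _ Hl0).
    intros e He; exists O; intros n _.
    replace (sum_f_R0 _ n) with 1; [now rewrite Rdist_eq|].
    induction n as [|n IH]; simpl; [unfold sin_n; simpl; field|].
    rewrite <- IH; ring.
  - rewrite El; field; easy. }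
apply is_pseries_odd_even.
- apply is_pseries_R, is_series_Reals.
  intros e He; destruct (Hl e He) as [N HN]; exists N; intros n Hn.
  rewrite (sum_eq _ (fun i => sin_n i * Rsqr u ^ i)); [now apply HN|].
  intros i _; rewrite Nat.even_even, Nat.div2_double; simpl.
  now rewrite Rmult_1_r.
- apply is_pseries_R, is_series_Reals; intros e He; exists O; intros n _.
  rewrite sum_eq_R0; [now rewrite Rdist_eq|].
  intros i _; rewrite Nat.even_odd; ring.
Qed.

Lemma u_over_sin_expansion : exists a, has_expansion u_over_sin a.
Proof.
destruct sinc_expansion as [a Ha].
destruct (has_expansion_inv _ _ Ha) as [b Hb].
- destruct (Req_EM_T 0 0); easy.
- exists b; revert Hb; apply has_expansion_ext, filter_forall.
  intros u; unfold u_over_sin; destruct (Req_EM_T u 0); [apply Rinv_1|].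
  apply Rinv_div.
Qed.

(** u cot u is cos u times u / sin u, also at 0, and cos is the derivative of sin. *)
Lemma u_cot_expansion : exists a, has_expansion u_cot a.
Proof.
destruct sinc_expansion as [a Ha], u_over_sin_expansion as [b Hb].
assert (Hs : has_expansion sin (PS_incr_1 a)).
{ generalize (has_expansion_incr_1 _ _ Ha).
  apply has_expansion_ext, filter_forall; intros u.
  destruct (Req_EM_T u 0) as [->|]; [rewrite sin_0|]; eqR; [ring|now field]. }
assert (Hc := has_expansion_derive _ _ _ Hs
  (filter_forall _ (fun u => is_derive_sin u))).
eexists; generalize (has_expansion_mult _ _ _ _ Hc Hb).
apply has_expansion_ext, filter_forall; intros u; unfold u_over_sin, u_cot.
destruct (Req_EM_T u 0) as [->|]; [rewrite cos_0; ring|].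
eqR; unfold Rdiv; ring.
Qed.

Definition csc_cot (m : nat) (u : R) : R := u_over_sin u * u_cot u ^ m.

Lemma csc_cot_expansion (m : nat) :
  has_expansion (csc_cot m) (fun r => coeff r (csc_cot m)).
Proof.
destruct u_over_sin_expansion as [a Ha], u_cot_expansion as [b Hb].
destruct (has_expansion_pow _ _ m Hb) as [c Hc].
eapply has_expansion_coeff; exact (has_expansion_mult _ _ _ _ Ha Hc).
Qed.

(** Away from 0, [csc_cot m] is u^(m+1) csc u cot^m u. Multiplying its derivative by u keeps every
    term a power series; the last one is written with two separate factors u to match two index
    shifts. *)
Lemma is_derive_csc_cot (m : nat) :
  locally 0 (fun u : R => u <> 0 ->
    exists l : R, is_derive (csc_cot m) u l /\
      u * l = INR (S m) * csc_cot m u - INR (S m) * csc_cot (S m) u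
              - INR m * (u * (u * csc_cot (pred m) u))).
Proof.
assert (HPI := PI_RGT_0).
exists (mkposreal PI HPI); intros u Hu Hu0.
change (Rabs (u - 0) < PI) in Hu; rewrite Rminus_0_r in Hu.
assert (Hs : sin u <> 0).
{ destruct (Rdichotomy _ _ Hu0).
  - rewrite Rabs_left in Hu by easy.
    rewrite <- (Ropp_involutive u), sin_neg.
    generalize (sin_gt_0 (- u)); lra.
  - rewrite Rabs_pos_eq in Hu by lra.
    generalize (sin_gt_0 u); lra. }
assert (Hloc : locally u (fun v => v <> 0)) by now apply open_neq.
set (A := u / sin u); set (K := u * (cos u / sin u)).
assert (HA : is_derive u_over_sin u ((A - A * K) / u)).
{ apply is_derive_ext_loc with (fun v => v / sin v).
  - revert Hloc; apply filter_imp; intros v Hv.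
    now unfold u_over_sin; destruct (Req_EM_T v 0).
  - evar_last; [apply (is_derive_div (fun v => v) sin)|].
    + apply is_derive_id.
    + apply is_derive_sin.
    + easy.
    + unfold A, K; simpl; unfold one; simpl; eqR; now field. }
assert (HK : is_derive u_cot u ((K - u ^ 2 - K ^ 2) / u)).
{ apply is_derive_ext_loc with (fun v => v * (cos v / sin v)).
  - revert Hloc; apply filter_imp; intros v Hv.
    now unfold u_cot; destruct (Req_EM_T v 0).
  - auto_derive; [easy|].
    assert (E := sin2_cos2 u); unfold Rsqr in E.
    unfold K; field_simplify_eq; [ring|easy]. }
assert (EA : u_over_sin u = A) by (unfold u_over_sin; now destruct (Req_EM_T u 0)).
assert (EK : u_cot u = K) by (unfold u_cot; now destruct (Req_EM_T u 0)).
eexists; split.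
- apply (is_derive_mult u_over_sin (fun v => u_cot v ^ m));
    [exact HA | | exact Rmult_comm].
  apply (is_derive_pow u_cot), HK.
- unfold csc_cot; rewrite EA, EK, S_INR; eqR.
  unfold plus, mult; simpl; destruct m as [|m]; simpl; now field.
Qed.

(** The coefficient of u^r in the identity of [is_derive_csc_cot]: u d/du multiplies it by r, and
    the factor u^2 lowers the index by 2, which leaves 0 for [r < 2]. *)
Lemma coeff_csc_cot (m r : nat) :
  INR (S m) * coeff r (csc_cot (S m)) =
  (INR (S m) - INR r) * coeff r (csc_cot m) -
  INR m * match r with S (S r) => coeff r (csc_cot (pred m)) | _ => 0 end.
Proof.
assert (Hd := has_expansion_incr_1 _ _ (has_expansion_derive _ _ _
  (csc_cot_expansion m) (has_expansion_is_derive _ _ (csc_cot_expansion m)))).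
assert (H := has_expansion_plus _ _ _ _
  (has_expansion_plus _ _ _ _
    (has_expansion_scal (INR (S m)) _ _ (csc_cot_expansion m))
    (has_expansion_scal (- INR (S m)) _ _ (csc_cot_expansion (S m))))
  (has_expansion_scal (- INR m) _ _ (has_expansion_incr_1 _ _
    (has_expansion_incr_1 _ _ (csc_cot_expansion (pred m)))))).
assert (E := fun HE => has_expansion_unique _ _ _ (has_expansion_ext _ _ _ HE Hd) H r).
lapply E.
- intros E'; clear - E'.
  unfold PS_plus, PS_scal, PS_incr_1, PS_derive in E'.
  set (M := INR (S m)) in *; clearbody M.
  destruct r as [|[|r]];
    cbn -[INR] in E'; unfold mult in E'; cbn -[INR] in E';
    [change (INR 0) with 0; lra | lra |].
  rewrite Rmult_minus_distr_r; lra.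
- generalize (filter_and _ _ (has_expansion_is_derive _ _ (csc_cot_expansion m))
    (is_derive_csc_cot m)).
  apply filter_imp; intros u [Hu1 Hu2].
  destruct (Req_dec u 0) as [->|Hu].
  + unfold csc_cot, u_over_sin, u_cot; destruct (Req_EM_T 0 0); [|easy].
    rewrite !pow1; ring.
  + destruct (Hu2 Hu) as [l [Hl El]].
    rewrite <- (is_derive_unique _ _ _ Hu1), (is_derive_unique _ _ _ Hl).
    eqR; lra.
Qed.

Lemma coeff_csc_cot_0 (m : nat) : coeff 0 (csc_cot m) = 1.
Proof.
rewrite (has_expansion_at_0 _ _ (csc_cot_expansion m)).
unfold csc_cot, u_over_sin, u_cot; destruct (Req_EM_T 0 0); [|easy].
rewrite pow1; ring.
Qed.

(** * Partial fractions of 1 / cosh *)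

(** The Leibniz bound for the tail. Applied to terms depending on x, it is the source of the
    estimates uniform in x. *)
Lemma alternating_series_bound (U : nat -> R) :
  Un_decreasing U -> is_lim_seq U 0 ->
  exists l : R, is_lim_seq (sum_f_R0 (tg_alt U)) l /\
    forall N, Rabs (sum_f_R0 (tg_alt U) N - l) <= U N.
Proof.
intros Hd H0; apply is_lim_seq_Reals in H0.
destruct (alternated_series U Hd H0) as [l Hl].
exists l; split; [now apply is_lim_seq_Reals|].
intros N; now apply (Alt_first_term_bound U l N N).
Qed.

Lemma is_derive_sum_f_R0 (f df : nat -> R -> R) (N : nat) (x : R) :
  (forall k, is_derive (f k) x (df k x)) ->
  is_derive (fun x => sum_f_R0 (fun k => f k x) N) x
    (sum_f_R0 (fun k => df k x) N).
Proof.
intros H; induction N as [|N IH]; [apply H|].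
exact (is_derive_plus _ (f (S N)) x _ _ IH (H (S N))).
Qed.

(** With y = PI s / 4 <= PI / 4, cos is at least 1 / sqrt 2 on [0, y], so sin y >= y / sqrt 2 and 2
    sin y cos y >= y >= s / 2. *)
Lemma half_le_sin (s : R) : 0 <= s <= 1 -> s / 2 <= sin (PI * s / 2).
Proof.
intros Hs.
assert (HPI := PI_RGT_0); assert (HPI2 := PI2_1).
set (y := PI * s / 4).
assert (Hy : 0 <= y <= PI / 4) by (unfold y; split; nra).
replace (PI * s / 2) with (2 * y) by (unfold y; field).
assert (Hc : forall t, 0 <= t <= PI / 4 -> / sqrt 2 <= cos t).
{ intros t Ht; replace (/ sqrt 2) with (cos (PI / 4)).
  - apply cos_decr_1; lra.
  - rewrite cos_PI4; unfold Rdiv; ring. }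
assert (H2 : 0 < sqrt 2) by (apply sqrt_lt_R0; lra).
assert (Hsin : y / sqrt 2 <= sin y).
{ destruct (MVT_gen sin 0 y cos) as [c [Hc1 Hc2]].
  - intros t _; apply is_derive_sin.
  - intros t _; apply continuity_sin.
  - rewrite Rmin_left, Rmax_right in Hc1 by lra.
    rewrite sin_0, !Rminus_0_r in Hc2; rewrite Hc2.
    generalize (Hc c ltac:(lra)); unfold Rdiv; nra. }
rewrite sin_2a.
assert (E : / sqrt 2 * / sqrt 2 = / 2)
  by (rewrite <- Rinv_mult, sqrt_sqrt; lra).
assert (Hi : 0 < / sqrt 2) by now apply Rinv_0_lt_compat.
assert (Hcy := Hc y Hy); unfold Rdiv in Hsin.
assert (y * / sqrt 2 * / sqrt 2 <= sin y * cos y)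
  by (apply Rmult_le_compat; nra).
rewrite Rmult_assoc, E in H.
assert (s / 2 <= y) by (unfold y; nra).
lra.
Qed.

(** The poles of 1 / cosh are [i * pole k] and their conjugates; on the real line [pole k] enters as
    a zero of cos. *)
Definition pole (k : nat) : R := (INR k + / 2) * PI.

Lemma pole_pos (k : nat) : 0 < pole k.
Proof.
apply Rmult_lt_0_compat; [|apply PI_RGT_0]; generalize (pos_INR k); lra.
Qed.

Lemma pole_S (k : nat) : pole (S k) = pole k + PI.
Proof. unfold pole; rewrite S_INR; ring. Qed.

Lemma pole_lt (k : nat) : pole k < pole (S k).
Proof. rewrite pole_S; generalize PI_RGT_0; lra. Qed.

Lemma pole_ge (k : nat) : INR k <= pole k.
Proof.
unfold pole; generalize (pos_INR k) PI2_1; nra.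
Qed.

Lemma sin_cos_pole (k : nat) : sin (pole k) = (-1) ^ k /\ cos (pole k) = 0.
Proof.
induction k as [|k [IHs IHc]].
- unfold pole; simpl; replace ((0 + / 2) * PI) with (PI / 2) by field.
  split; [apply sin_PI2 | apply cos_PI2].
- rewrite pole_S, neg_sin, neg_cos, IHs, IHc; split; simpl; ring.
Qed.

Lemma inv_pole_pow_lim (n : nat) (c : R) :
  is_lim_seq (fun k => c / pole k ^ S n) 0.
Proof.
assert (H1 : is_lim_seq (fun k => / pole k) 0).
{ apply (is_lim_seq_inv pole p_infty); [|easy].
  apply (is_lim_seq_le_p_loc INR); [|apply is_lim_seq_INR].
  exists O; intros k _; apply pole_ge. }
induction n as [|n IH].
- apply is_lim_seq_ext with (fun k => c * / pole k).
  + intros k; simpl; now rewrite Rmult_1_r.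
  + replace (Finite 0) with (Rbar_mult c 0) by (simpl; f_equal; ring).
    now apply is_lim_seq_scal_l.
- apply is_lim_seq_ext with (fun k => / pole k * (c / pole k ^ S n)).
  + intros k; assert (H := pole_pos k); simpl; field.
    split; [apply pow_nonzero|]; lra.
  + replace (Finite 0) with (Finite (0 * 0)) by (f_equal; ring).
    now apply is_lim_seq_mult'.
Qed.

(** Each product 2 cos a sin b is sin (a + b) - sin (a - b), and the sum telescopes. *)
Lemma dirichlet_kernel (N : nat) (s : R) :
  sum_f_R0 (fun k => 2 * cos (pole k * s)) N * sin (PI * s / 2) =
  sin (INR (S N) * PI * s).
Proof.
induction N as [|N IH].
- simpl sum_f_R0; unfold pole; simpl.
  replace ((0 + / 2) * PI * s) with (PI * s / 2) by field.
  replace (1 * PI * s) with (2 * (PI * s / 2)) by field.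
  rewrite sin_2a; ring.
- simpl sum_f_R0; rewrite Rmult_plus_distr_r, IH; unfold pole.
  rewrite (S_INR (S N)); set (L := INR (S N)).
  replace (L * PI * s) with ((L + / 2) * PI * s - PI * s / 2) by field.
  replace ((L + 1) * PI * s) with ((L + / 2) * PI * s + PI * s / 2) by field.
  rewrite sin_minus, sin_plus; ring.
Qed.

(* The integral over [s, 1] of the Dirichlet kernel of [dirichlet_kernel]. *)
Definition kernel_primitive (N : nat) (s : R) : R :=
  sum_f_R0 (fun k => 2 * ((-1) ^ k - sin (pole k * s)) / pole k) N.

Lemma is_derive_kernel_primitive (N : nat) (s : R) :
  is_derive (kernel_primitive N) s
    (- sum_f_R0 (fun k => 2 * cos (pole k * s)) N).
Proof.
replace (- sum_f_R0 (fun k => 2 * cos (pole k * s)) N)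
  with (sum_f_R0 (fun k => 2 * cos (pole k * s) * -1) N).
- apply (is_derive_sum_f_R0
    (fun k s => 2 * ((-1) ^ k - sin (pole k * s)) / pole k)
    (fun k s => 2 * cos (pole k * s) * -1)).
  intros k; assert (H := pole_pos k); auto_derive; [easy|].
  field; lra.
- rewrite <- scal_sum; ring.
Qed.

Lemma kernel_primitive_1 (N : nat) : kernel_primitive N 1 = 0.
Proof.
apply sum_eq_R0; intros k _.
rewrite Rmult_1_r, (proj1 (sin_cos_pole k)).
unfold Rdiv; ring.
Qed.

(** The kernel is sin (L t) / sin (PI t / 2), so an integration by parts gains 1 / L at the cost of
    1 / s. No integral is formed: in the derivative of [g e] the sine terms cancel and (e - cos (L
    t)) h' remains, of constant sign for e = 1 and for e = -1. *)
Lemma kernel_primitive_bound (N : nat) (s : R) :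
  0 < s <= 1 -> Rabs (kernel_primitive N s) <= 4 / (INR (S N) * s).
Proof.
intros Hs.
assert (HPI := PI_RGT_0); assert (HPI2 := PI2_1).
set (L := INR (S N) * PI).
assert (HN : 0 < INR (S N)) by (apply lt_0_INR; lia).
assert (HL : 0 < L) by now apply Rmult_lt_0_compat.
assert (Hsin : forall t, 0 < t <= 1 -> 0 < sin (PI * t / 2)).
{ intros t Ht; generalize (half_le_sin t ltac:(lra)); lra. }
set (h := fun t => / (L * sin (PI * t / 2))).
(* [g e] is monotone for [e = 1] and [e = -1], which compares
   [kernel_primitive] with [cos (L t) * h t]. *)
set (g := fun e t => kernel_primitive N t + (e - cos (L * t)) * h t).
assert (Hg : forall e t, 0 < t <= 1 -> is_derive (g e) t
  ((cos (L * t) - e) * (cos (PI * t / 2) * (PI / 2) / (L * sin (PI * t / 2) ^ 2)))).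
{ intros e t Ht; assert (Ht' := Hsin t Ht).
  evar_last.
  - apply (is_derive_plus (kernel_primitive N)
      (fun t => (e - cos (L * t)) * h t)); [apply is_derive_kernel_primitive|].
    unfold h; auto_derive; [|reflexivity].
    apply Rgt_not_eq, Rmult_lt_0_compat; [easy|exact Ht'].
  - assert (E := dirichlet_kernel N t); fold L in E.
    assert (E' : sum_f_R0 (fun k => 2 * cos (pole k * t)) N =
      sin (L * t) / sin (PI * t / 2)) by (rewrite <- E; field; lra).
    rewrite E'; unfold plus; simpl; unfold Rdiv in Ht' |- *; eqR.
    field; split; lra. }
assert (Hmvt : forall e, exists c, s <= c <= 1 /\ g e 1 - g e s =
   (cos (L * c) - e) * (cos (PI * c / 2) * (PI / 2) / (L * sin (PI * c / 2) ^ 2))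
   * (1 - s)).
{ intros e.
  destruct (MVT_gen (g e) s 1 (fun t => (cos (L * t) - e) *
    (cos (PI * t / 2) * (PI / 2) / (L * sin (PI * t / 2) ^ 2)))) as [c [Hc E]].
  - intros t Ht; rewrite Rmin_left, Rmax_right in Ht by lra.
    apply Hg; lra.
  - intros t Ht; rewrite Rmin_left, Rmax_right in Ht by lra.
    apply continuity_pt_filterlim.
    apply (ex_derive_continuous (g e)); eexists; apply Hg; lra.
  - rewrite Rmin_left, Rmax_right in Hc by lra; now exists c. }
assert (Hpos : forall c, s <= c <= 1 ->
  0 <= cos (PI * c / 2) * (PI / 2) / (L * sin (PI * c / 2) ^ 2) * (1 - s)).
{ intros c Hc; apply Rmult_le_pos; [|lra].
  apply Rdiv_le_0_compat.
  - apply Rmult_le_pos; [|lra]; apply cos_ge_0; nra.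
  - apply Rmult_lt_0_compat; [easy|]; apply pow_lt, Hsin; lra. }
assert (E1 : forall e, g e 1 = (e - cos (L * 1)) / L).
{ intros e; unfold g, h; rewrite kernel_primitive_1.
  replace (PI * 1 / 2) with (PI / 2) by field; rewrite sin_PI2; field; lra. }
assert (HB := COS_bound (L * 1)); assert (HBs := COS_bound (L * s)).
assert (Hh : 0 < h s <= 2 / (L * s)).
{ assert (H1 := Hsin s Hs); assert (H2 := half_le_sin s ltac:(lra)).
  unfold h; split.
  - apply Rinv_0_lt_compat, Rmult_lt_0_compat; easy.
  - replace (2 / (L * s)) with (/ (L * (s / 2))) by (field; split; lra).
    apply Rinv_le_contravar; [|apply Rmult_le_compat_l; lra].
    apply Rmult_lt_0_compat; lra. }
assert (Hup : kernel_primitive N s <= 2 * h s).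
{ destruct (Hmvt (-1)) as [c [Hc E]].
  assert (HBc := COS_bound (L * c)); assert (HP := Hpos c Hc).
  rewrite E1, Rmult_assoc in E.
  assert (H1 : (-1 - cos (L * 1)) / L <= 0).
  { apply Rmult_le_reg_r with L; [easy|].
    unfold Rdiv; rewrite Rmult_assoc, Rinv_l by lra; lra. }
  unfold g in E; nra. }
assert (Hlo : - (2 * h s) <= kernel_primitive N s).
{ destruct (Hmvt 1) as [c [Hc E]].
  assert (HBc := COS_bound (L * c)); assert (HP := Hpos c Hc).
  rewrite E1, Rmult_assoc in E.
  assert (H1 : 0 <= (1 - cos (L * 1)) / L) by (apply Rdiv_le_0_compat; lra).
  unfold g in E; nra. }
apply Rle_trans with (2 * h s); [now apply Rabs_le|].
apply Rle_trans with (4 / (L * s)); [unfold Rdiv in *; lra|].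
apply Rmult_le_compat_l; [lra|]; apply Rinv_le_contravar; unfold L; [nra|].
apply Rmult_le_compat_r; nra.
Qed.

(** The factor s is what matters: it cancels the 1 / s of [kernel_primitive_bound]. *)
Lemma sinh_bound (x s : R) :
  0 <= x -> 0 <= s <= 1 -> Rabs (sinh (x * s)) <= x * s * exp x.
Proof.
intros Hx Hs.
assert (Hxs : 0 <= x * s <= x) by (split; nra).
destruct (MVT_gen sinh 0 (x * s) cosh) as [c [Hc E]].
- intros t _; apply is_derive_sinh.
- intros t _; apply continuity_pt_filterlim, (ex_derive_continuous sinh).
  eexists; apply is_derive_sinh.
- rewrite Rmin_left, Rmax_right in Hc by lra.
  rewrite sinh_0, !Rminus_0_r in E.
  assert (Hcosh := cosh_gt_0 c).
  rewrite E, Rabs_mult, (Rabs_pos_eq (cosh c)), (Rabs_pos_eq (x * s)) by lra.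
  rewrite Rmult_comm; apply Rmult_le_compat_l; [lra|].
  assert (He : forall y, y <= x -> exp y <= exp x).
  { intros y [Hy| ->]; [apply Rlt_le, exp_increasing, Hy | apply Rle_refl]. }
  unfold cosh; generalize (He c ltac:(lra)) (He (- c) ltac:(lra)); lra.
Qed.

(** The sign (-1)^k is supplied by [tg_alt] and (-1)^p is kept outside the sums, so that the
    alternating series test applies to positive terms. *)
Definition sech_term (p : nat) (x : R) (k : nat) : R :=
  2 * pole k / (pole k ^ (2 * p) * (pole k ^ 2 + x ^ 2)).

Definition sech_sum (p N : nat) (x : R) : R :=
  sum_f_R0 (tg_alt (sech_term p x)) N.

(* Both sides come from integrating cosh (x s) against the Dirichlet kernel on
   [0, 1]; [psi] absorbs the integration by parts, which leaves the integral of
   x sinh (x s) * kernel_primitive N s, of order 1 / N. *)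
Lemma sech_sum_bound (N : nat) (x : R) : 0 <= x ->
  Rabs (cosh x * sech_sum 0 N x - sech_sum 0 N 0) <= 4 * x ^ 2 * exp x / INR (S N).
Proof.
intros Hx.
set (psi := fun s => sum_f_R0 (fun k =>
  2 * (x * sinh (x * s) * cos (pole k * s) + pole k * cosh (x * s) * sin (pole k * s))
  / (pole k ^ 2 + x ^ 2)) N + cosh (x * s) * kernel_primitive N s).
assert (Hpsi : forall s, is_derive psi s
  (x * sinh (x * s) * kernel_primitive N s)).
{ intros s; set (S := sum_f_R0 (fun k => 2 * cos (pole k * s)) N).
  evar_last.
  - apply (is_derive_plus (fun s => sum_f_R0 _ N)
      (fun s => cosh (x * s) * kernel_primitive N s)).
    + apply (is_derive_sum_f_R0 _
        (fun k s => 2 * cos (pole k * s) * cosh (x * s))).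
      intros k; assert (Hk := pole_pos k).
      assert (Hk2 : pole k ^ 2 + x ^ 2 <> 0) by nra.
      auto_derive; [exact I|]; field; nra.
    + apply (is_derive_mult (fun s => cosh (x * s)) (kernel_primitive N));
       [|apply is_derive_kernel_primitive | exact Rmult_comm].
      apply (is_derive_comp cosh (fun s => x * s)); [apply is_derive_cosh|].
      auto_derive; [easy|reflexivity].
  - rewrite <- scal_sum; fold S; unfold plus, mult, scal; simpl.
    unfold mult; simpl; eqR; ring. }
assert (E0 : psi 0 = sech_sum 0 N 0).
{ unfold psi, sech_sum, kernel_primitive, tg_alt, sech_term.
  rewrite Rmult_0_r, cosh_0, Rmult_1_l, <- sum_plus.
  apply sum_eq; intros k _; assert (Hk := pole_pos k).
  assert (Hk2 : pole k ^ 2 + x ^ 2 <> 0) by nra.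
  rewrite Rmult_0_r, sin_0, sinh_0; simpl; field; split; nra. }
assert (E1 : psi 1 = cosh x * sech_sum 0 N x).
{ unfold psi, sech_sum; rewrite kernel_primitive_1, Rmult_0_r, Rplus_0_r.
  rewrite scal_sum; apply sum_eq; intros k _; unfold tg_alt, sech_term.
  rewrite !Rmult_1_r, (proj1 (sin_cos_pole k)), (proj2 (sin_cos_pole k)).
  assert (Hk := pole_pos k).
  assert (Hk2 : pole k ^ 2 + x ^ 2 <> 0) by nra.
  simpl; field; simpl in Hk2; nra. }
destruct (MVT_gen psi 0 1 (fun s => x * sinh (x * s) * kernel_primitive N s))
  as [c [Hc E]].
- intros s _; apply Hpsi.
- intros s _; apply continuity_pt_filterlim, (ex_derive_continuous psi).
  eexists; apply Hpsi.
- rewrite Rmin_left, Rmax_right in Hc by lra.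
  rewrite <- E0, <- E1, E, Rminus_0_r, Rmult_1_r.
  assert (HN : 0 < INR (S N)) by (apply lt_0_INR; lia).
  assert (He := exp_pos x).
  assert (Hpos : 0 <= 4 * x ^ 2 * exp x / INR (S N)).
  { apply Rdiv_le_0_compat; [|easy]; apply Rmult_le_pos; nra. }
  destruct (Req_dec c 0) as [->|Hc0].
  + rewrite Rmult_0_r, sinh_0, Rmult_0_r, Rmult_0_l, Rabs_R0; exact Hpos.
  + rewrite 2!Rabs_mult, (Rabs_pos_eq x Hx).
    apply Rle_trans with (x * (x * c * exp x) * (4 / (INR (S N) * c))).
    * apply Rmult_le_compat; try apply Rabs_pos.
      -- apply Rmult_le_pos; [easy | apply Rabs_pos].
      -- apply Rmult_le_compat_l; [easy|]; now apply sinh_bound.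
      -- apply kernel_primitive_bound; lra.
    * right; field; split; lra.
Qed.

(** At [x = 0] the terms are (4 / PI) / (2 k + 1), and the series is Leibniz's for PI / 4. *)
Lemma sech_sum_lim_0 : is_lim_seq (fun N => sech_sum 0 N 0) 1.
Proof.
assert (HPI := PI_RGT_0).
assert (H : is_lim_seq (sum_f_R0 (tg_alt PI_tg)) (PI / 4)).
{ rewrite <- Alt_PI_eq; unfold Alt_PI; destruct exist_PI as [l Hl].
  apply is_lim_seq_Reals; now replace (4 * l / 4) with l by field. }
apply is_lim_seq_ext with (fun N => 4 / PI * sum_f_R0 (tg_alt PI_tg) N).
- intros N; rewrite scal_sum; apply sum_eq; intros k _.
  unfold tg_alt, sech_term, PI_tg, pole.
  rewrite plus_INR, mult_INR; simpl; assert (Hk := pos_INR k).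
  field; repeat split; nra.
- replace (Finite 1) with (Rbar_mult (4 / PI) (PI / 4)).
  + now apply is_lim_seq_scal_l.
  + simpl; f_equal; field; lra.
Qed.

Lemma sech_sum_lim (x : R) :
  0 <= x -> is_lim_seq (fun N => sech_sum 0 N x) (/ cosh x).
Proof.
intros Hx; assert (Hc := cosh_gt_0 x).
assert (H : is_lim_seq (fun N => cosh x * sech_sum 0 N x - sech_sum 0 N 0) 0).
{ apply is_lim_seq_abs_0.
  apply is_lim_seq_le_le with (fun _ => 0) (fun N => 4 * x ^ 2 * exp x * / INR (S N)).
  - intros N; split; [apply Rabs_pos | now apply sech_sum_bound].
  - apply is_lim_seq_const.
  - replace (Finite 0) with (Rbar_mult (4 * x ^ 2 * exp x) 0)
      by (simpl; f_equal; ring).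
    apply is_lim_seq_scal_l.
    apply (is_lim_seq_inv (fun N => INR (S N)) p_infty); [|easy].
    apply (is_lim_seq_incr_1 INR), is_lim_seq_INR. }
apply is_lim_seq_ext with (fun N => / cosh x *
  (cosh x * sech_sum 0 N x - sech_sum 0 N 0 + sech_sum 0 N 0)).
- intros N; field; lra.
- replace (Finite (/ cosh x)) with (Rbar_mult (/ cosh x) (0 + 1))
    by (simpl; f_equal; ring).
  apply is_lim_seq_scal_l, is_lim_seq_plus'; [exact H | apply sech_sum_lim_0].
Qed.

(** At exponent 0 the term 2 a / (a^2 + x^2) grows until a = x; dividing by at least a^2 removes the
    numerator and makes it decrease from the start. *)
Lemma sech_term_decreasing (p : nat) (x : R) : Un_decreasing (sech_term (S p) x).
Proof.
intros k; unfold sech_term.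
assert (E : forall j, 2 * pole j / (pole j ^ (2 * S p) * (pole j ^ 2 + x ^ 2)) =
  2 * / (pole j ^ (2 * p + 1) * (pole j ^ 2 + x ^ 2))).
{ intros j; assert (Hj := pole_pos j).
  replace (2 * S p)%nat with (S (2 * p + 1)) by lia.
  assert (0 < pole j ^ (2 * p + 1)) by now apply pow_lt.
  assert (0 < pole j ^ 2 + x ^ 2) by nra.
  rewrite <- (tech_pow_Rmult _ (2 * p + 1)).
  set (q := pole j ^ (2 * p + 1)) in *; clearbody q; field; repeat split; lra. }
rewrite !E; apply Rmult_le_compat_l; [lra|].
assert (Hk := pole_pos k); assert (Hlt := pole_lt k).
assert (0 < pole k ^ (2 * p + 1)) by now apply pow_lt.
apply Rinv_le_contravar; [apply Rmult_lt_0_compat; nra|].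
apply Rmult_le_compat; try nra.
apply pow_incr; lra.
Qed.

Lemma sech_term_0 (p k : nat) : sech_term p 0 k = 2 / pole k ^ S (2 * p).
Proof.
assert (Hk := pole_pos k); assert (0 < pole k ^ (2 * p)) by now apply pow_lt.
unfold sech_term; rewrite <- (tech_pow_Rmult _ (2 * p)).
set (q := pole k ^ (2 * p)) in *; clearbody q; field; split; lra.
Qed.

Lemma sech_term_le (p : nat) (x : R) (k : nat) :
  0 <= sech_term p x k <= sech_term p 0 k.
Proof.
assert (Hk := pole_pos k); assert (0 < pole k ^ (2 * p)) by now apply pow_lt.
assert (0 < pole k ^ 2) by now apply pow_lt.
assert (0 <= x ^ 2) by nra.
unfold sech_term; split.
- apply Rdiv_le_0_compat; [lra | apply Rmult_lt_0_compat; lra].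
- apply Rmult_le_compat_l; [lra|]; apply Rinv_le_contravar.
  + apply Rmult_lt_0_compat; lra.
  + apply Rmult_le_compat_l; lra.
Qed.

Lemma sech_term_lim (p : nat) (x : R) : is_lim_seq (sech_term p x) 0.
Proof.
apply is_lim_seq_le_le with (fun _ => 0) (sech_term p 0).
- intros k; apply sech_term_le.
- apply is_lim_seq_const.
- apply is_lim_seq_ext with (fun k => 2 / pole k ^ S (2 * p)).
  + intros k; now rewrite sech_term_0.
  + apply inv_pole_pow_lim.
Qed.

(** 1 / (a^2 + x^2) = 1 / a^2 - x^2 / (a^2 (a^2 + x^2)): the removal of the constant term, carried
    out on finite sums. *)
Lemma sech_sum_step (p N : nat) (x : R) :
  sech_sum p N x = sech_sum p N 0 - x ^ 2 * sech_sum (S p) N x.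
Proof.
unfold sech_sum; rewrite scal_sum, <- minus_sum; apply sum_eq; intros k _.
assert (Hk := pole_pos k); assert (0 < pole k ^ (2 * p)) by now apply pow_lt.
assert (0 < pole k ^ 2 + x ^ 2) by nra.
unfold tg_alt, sech_term.
replace (2 * S p)%nat with (S (S (2 * p))) by lia.
rewrite <- !tech_pow_Rmult.
set (q := pole k ^ (2 * p)) in *; clearbody q; field; repeat split; nra.
Qed.

Lemma at_right_lim_eq (f : R -> R) (t s C : R) :
  filterlim f (at_right 0) (locally t) ->
  (forall x, 0 < x -> Rabs (f x - s) <= C * x ^ 2) -> t = s.
Proof.
intros Hf Hb.
apply (filterlim_locally_unique f t s Hf).
apply filterlim_locally; intros e.
assert (He := cond_pos e); assert (HC := Rabs_pos C).
assert (Hd : 0 < Rmin 1 (e / (Rabs C + 1))).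
{ apply Rmin_glb_lt; [lra|]; apply Rdiv_lt_0_compat; lra. }
exists (mkposreal _ Hd); intros x Hx H0.
change (Rabs (x - 0) < Rmin 1 (e / (Rabs C + 1))) in Hx.
rewrite Rminus_0_r, Rabs_pos_eq in Hx by lra.
assert (H1 := Rmin_l 1 (e / (Rabs C + 1))).
assert (H2 := Rmin_r 1 (e / (Rabs C + 1))).
apply Rle_lt_trans with (1 := Hb x H0).
apply Rle_lt_trans with ((Rabs C + 1) * x).
- assert (H3 := Rle_abs C); assert (Hx2 : 0 <= x ^ 2 <= x) by (split; nra).
  apply Rle_trans with (Rabs C * x ^ 2); [|nra].
  now apply Rmult_le_compat_r.
- apply Rlt_le_trans with ((Rabs C + 1) * (e / (Rabs C + 1))).
  + apply Rmult_lt_compat_l; lra.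
  + right; field; lra.
Qed.

Definition taylor_quot (m n : nat) (x : R) : R :=
  (sech_tanh m x - trunc (fun i => coeff i (sech_tanh m)) n x) / x ^ n.

Lemma taylor_quot_S (m n : nat) (x : R) : x <> 0 ->
  taylor_quot m (S n) x = (taylor_quot m n x - coeff n (sech_tanh m)) / x.
Proof.
intros Hx; unfold taylor_quot; simpl; field.
now split; try apply pow_nonzero.
Qed.

(** In the induction the sums at 0 converge to some s, and the point is that s is the Taylor
    coefficient of order 2p. Both are the limit of [taylor_quot 0 (2 * p)] at 0: the coefficient by
    [trunc_lim_0], s by an O(x^2) error from [sech_sum_step]. The next coefficient vanishes by
    parity, so two orders are passed at once. *)
Lemma taylor_quot_sech_sum (p : nat) (x : R) : 0 < x ->
  is_lim_seq (fun N => (-1) ^ p * sech_sum p N x) (taylor_quot 0 (2 * p) x).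
Proof.
revert x; induction p as [|p IH]; intros x Hx.
- replace (taylor_quot _ _ _) with (/ cosh x).
  + apply is_lim_seq_ext with (fun N => sech_sum 0 N x);
      [intros N; simpl; ring|]; apply sech_sum_lim; lra.
  + assert (Hc := cosh_gt_0 x); unfold taylor_quot, sech_tanh; simpl; field; lra.
- set (t := coeff (2 * p) (sech_tanh 0)).
  assert (H0 : exists s : R, is_lim_seq (fun N => (-1) ^ p * sech_sum p N 0) s).
  { destruct (alternating_series_bound (sech_term p 0)) as [s [Hs _]].
    - intros k; rewrite !sech_term_0; apply Rmult_le_compat_l; [lra|].
      assert (Hk := pole_pos k); assert (Hlt := pole_lt k).
      apply Rinv_le_contravar; [now apply pow_lt | apply pow_incr; lra].
    - apply sech_term_lim.
    - exists ((-1) ^ p * s).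
      exact (is_lim_seq_scal_l _ ((-1) ^ p) _ Hs). }
  destruct H0 as [s Hs].
  assert (Hlim : forall y, 0 < y -> is_lim_seq
    (fun N => (-1) ^ S p * sech_sum (S p) N y) ((taylor_quot 0 (2 * p) y - s) / y ^ 2)).
  { intros y Hy.
    apply is_lim_seq_ext with (fun N => / y ^ 2 *
      ((-1) ^ p * sech_sum p N y - (-1) ^ p * sech_sum p N 0)).
    - intros N; rewrite (sech_sum_step p N y); simpl; field; lra.
    - unfold Rdiv; rewrite Rmult_comm.
      apply (is_lim_seq_scal_l _ _ (Finite (taylor_quot 0 (2 * p) y - s))).
      apply is_lim_seq_minus'; [now apply IH | exact Hs]. }
  assert (Hts : t = s).
  { apply (at_right_lim_eq (taylor_quot 0 (2 * p)) _ _ (2 * sech_term (S p) 0 0)).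
    - apply (trunc_lim_0 _ _ (2 * p) (sech_tanh_expansion 0)).
    - intros y Hy.
      destruct (alternating_series_bound (sech_term (S p) y)) as [l [Hl Hb]];
        [apply sech_term_decreasing | apply sech_term_lim|].
      assert (E := is_lim_seq_unique _ _ (Hlim y Hy)).
      assert (E' := is_lim_seq_unique _ _
        (is_lim_seq_scal_l _ ((-1) ^ S p) _ Hl)).
      unfold sech_sum in E; rewrite E in E'; injection E' as E'.
      replace (taylor_quot 0 (2 * p) y - s) with ((-1) ^ S p * l * y ^ 2)
        by (simpl in *; rewrite <- E'; field; lra).
      rewrite Rabs_mult, Rabs_mult, pow_1_abs, Rmult_1_l.
      rewrite (Rabs_pos_eq (y ^ 2)) by nra.
      apply Rmult_le_compat_r; [nra|].
      specialize (Hb O); unfold tg_alt in Hb; simpl in Hb.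
      rewrite Rmult_1_l in Hb.
      assert (H1 := sech_term_le (S p) y 0).
      apply Rabs_le; apply Rabs_le_between in Hb; lra. }
  replace (taylor_quot 0 (2 * S p) x) with ((taylor_quot 0 (2 * p) x - s) / x ^ 2);
    [now apply Hlim|].
  replace (2 * S p)%nat with (S (S (2 * p))) by lia.
  rewrite !taylor_quot_S by lra.
  rewrite (coeff_sech_tanh_parity 0 (S (2 * p))) by (exists p; lia).
  fold t; rewrite Hts; field; lra.
Qed.

(** * Integration by parts *)

(** [Phi] is tied to [f] by integrals and not by derivatives, because for [m = 0] it is a limit of
    primitives. *)
Lemma is_RInt_gen_primitive (f Phi : R -> R) (la lb : R) :
  (forall a b, 0 < a < b -> is_RInt f a b (Phi b - Phi a)) ->
  filterlim Phi (at_right 0) (locally la) ->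
  filterlim Phi (Rbar_locally p_infty) (locally lb) ->
  is_RInt_gen f (at_right 0) (Rbar_locally p_infty) (lb - la).
Proof.
intros HI Ha Hb P HP.
assert (Hlim : filterlim (fun ab : R * R => Phi (snd ab) - Phi (fst ab))
  (filter_prod (at_right 0) (Rbar_locally p_infty)) (locally (lb - la))).
{ apply (filterlim_comp_2 (G := locally lb) (H := locally (- la))
    (fun ab : R * R => Phi (snd ab)) (fun ab : R * R => - Phi (fst ab)) Rplus).
  - apply (filterlim_comp _ _ _ snd Phi _ (Rbar_locally p_infty));
      [apply filterlim_snd | exact Hb].
  - apply (filterlim_comp _ _ _ (fun ab : R * R => Phi (fst ab)) Ropp _ (locally la)).
    + apply (filterlim_comp _ _ _ fst Phi _ (at_right 0));
        [apply filterlim_fst | exact Ha].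
    + apply (filterlim_opp la).
  - apply (filterlim_plus lb (- la)). }
assert (H01 : filter_prod (at_right 0) (Rbar_locally p_infty)
  (fun ab : R * R => 0 < fst ab < snd ab)).
{ apply Filter_prod with (fun a => 0 < a < 1) (fun b => 1 < b).
  - exists (mkposreal 1 Rlt_0_1); intros y Hy Hy0; split; [easy|].
    change (Rabs (y - 0) < 1) in Hy.
    rewrite Rminus_0_r, Rabs_pos_eq in Hy; lra.
  - now exists 1.
  - simpl; intros x y; lra. }
assert (HQ : filter_prod (at_right 0) (Rbar_locally p_infty)
  (fun ab : R * R => P (Phi (snd ab) - Phi (fst ab)))) by exact (Hlim P HP).
generalize (filter_and _ _ HQ H01).
unfold filtermapi; apply filter_imp; intros [a b] [H1 H2]; simpl in *.
exists (Phi b - Phi a); split; [now apply HI | exact H1].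
Qed.

Lemma continuous_taylor_quot (m n : nat) (x : R) :
  x <> 0 -> continuous (taylor_quot m n) x.
Proof.
intros Hx.
apply (continuous_mult (fun x => sech_tanh m x - trunc _ n x) (fun x => / x ^ n)).
- apply (continuous_minus (sech_tanh m) (trunc _ n)); [|apply continuous_trunc].
  apply (ex_derive_continuous (sech_tanh m)); eexists; apply is_derive_sech_tanh.
- apply (ex_derive_continuous (fun x => / x ^ n)); auto_derive.
  now apply pow_nonzero.
Qed.

Lemma trunc_sech_tanh_derive (m n : nat) (x : R) :
  trunc (PS_derive (fun i => coeff i (sech_tanh m))) n x =
  INR m * trunc (fun i => coeff i (sech_tanh (pred m))) n x -
  INR (S m) * trunc (fun i => coeff i (sech_tanh (S m))) n x.
Proof.
induction n as [|n IH]; [simpl; ring|].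
cbn [trunc]; rewrite IH; unfold PS_derive at 1.
rewrite coeff_sech_tanh_derive; ring.
Qed.

(** As the coefficient of order [n] vanishes, one more Taylor term may be included; differentiation
    then leaves exactly the terms of order below [n], as the remainders on the right require. *)
Lemma is_derive_taylor_quot (m n : nat) (x : R) :
  coeff n (sech_tanh m) = 0 -> x <> 0 ->
  is_derive (taylor_quot m n) x
    (INR m * taylor_quot (pred m) n x - INR (S m) * taylor_quot (S m) n x
     - INR n * taylor_quot m (S n) x).
Proof.
intros H0 Hx.
apply is_derive_ext with (fun x =>
  (sech_tanh m x - trunc (fun i => coeff i (sech_tanh m)) (S n) x) / x ^ n).
{ intros y; unfold taylor_quot; simpl; rewrite H0; do 2 f_equal; eqR; ring. }
assert (Hp : x ^ n <> 0) by now apply pow_nonzero.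
evar_last.
- apply (is_derive_div (fun x => sech_tanh m x - trunc _ (S n) x) (fun x => x ^ n)).
  + apply (is_derive_minus (sech_tanh m) (trunc _ (S n)));
      [apply is_derive_sech_tanh | apply is_derive_trunc].
  + apply (is_derive_pow (fun x => x) n x 1); auto_derive; easy.
  + exact Hp.
- rewrite trunc_sech_tanh_derive; unfold taylor_quot, minus, plus, opp.
  simpl trunc; rewrite H0; cbn -[INR pow].
  eqR; destruct n as [|n]; [simpl; field; easy|].
  simpl pred; rewrite <- (tech_pow_Rmult x (S n)), <- (tech_pow_Rmult x n) in *.
  assert (x ^ n <> 0) by now apply pow_nonzero.
  field; now split.
Qed.

Lemma sech_tanh_bound (m : nat) (x : R) : Rabs (sech_tanh m x) <= 1.
Proof.
assert (Hc := cosh_gt_0 x); assert (H2 := cosh_sqr x).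
assert (H1 : 1 <= cosh x) by nra.
assert (Ht : Rabs (tanh x) <= 1).
{ unfold tanh, Rdiv; rewrite Rabs_mult, Rabs_inv, (Rabs_pos_eq (cosh x)) by lra.
  apply Rmult_le_reg_r with (cosh x); [easy|].
  rewrite Rmult_assoc, Rinv_l, Rmult_1_r, Rmult_1_l by lra.
  apply Rabs_le; nra. }
unfold sech_tanh, Rdiv; rewrite Rabs_mult, Rabs_inv, (Rabs_pos_eq (cosh x)) by lra.
rewrite <- RPow_abs, <- (Rmult_1_r 1).
apply Rmult_le_compat.
- apply pow_le, Rabs_pos.
- apply Rlt_le, Rinv_0_lt_compat, Hc.
- rewrite <- (pow1 m); apply pow_incr; split; [apply Rabs_pos | exact Ht].
- rewrite <- Rinv_1; apply Rinv_le_contravar; lra.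
Qed.

Lemma taylor_quot_lim_p_infty (m n : nat) :
  (1 <= n)%nat ->
  filterlim (taylor_quot m n) (Rbar_locally p_infty) (locally 0).
Proof.
intros Hn.
assert (H1 : is_lim (fun x => sech_tanh m x / x ^ n) p_infty 0).
{ apply (is_lim_le_le_loc (fun x => - (1 * / x)) (fun x => 1 * / x)).
  - exists 1; intros x Hx; apply Rabs_le_between.
    unfold Rdiv; rewrite Rabs_mult; apply Rmult_le_compat; try apply Rabs_pos.
    + apply sech_tanh_bound.
    + rewrite Rabs_inv, Rabs_pos_eq by (apply pow_le; lra).
      apply Rinv_le_contravar; [lra|].
      rewrite <- (pow_1 x) at 1; apply Rle_pow; [lra | easy].
  - replace (Finite 0) with (Rbar_opp (Rbar_mult 1 0)) by (simpl; f_equal; ring).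
    apply is_lim_opp, is_lim_scal_l.
    apply (is_lim_inv (fun x => x) p_infty p_infty); [apply is_lim_id|easy].
  - replace (Finite 0) with (Rbar_mult 1 0) by (simpl; f_equal; ring).
    apply is_lim_scal_l.
    apply (is_lim_inv (fun x => x) p_infty p_infty); [apply is_lim_id|easy]. }
assert (H2 := trunc_lim_p_infty (fun i => coeff i (sech_tanh m)) n).
apply filterlim_ext with (fun x => sech_tanh m x / x ^ n -
  trunc (fun i => coeff i (sech_tanh m)) n x / x ^ n).
- intros x; unfold taylor_quot, Rdiv; ring.
- change (is_lim (fun x => sech_tanh m x / x ^ n -
    trunc (fun i => coeff i (sech_tanh m)) n x / x ^ n) p_infty 0).
  replace (Finite 0) with (Finite (0 - 0)) by (f_equal; ring).
  now apply is_lim_minus'.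
Qed.

(** The primitive [taylor_quot m n] tends at 0 to the coefficient of order [n], zero by parity, and
    to 0 at infinity. Only the combination is integrated; the separate integrals are not yet known
    to converge. *)
Lemma taylor_quot_by_parts (m n : nat) :
  (1 <= n)%nat -> Nat.Odd (n + m) ->
  is_RInt_gen (fun x => INR m * taylor_quot (pred m) n x
     - INR (S m) * taylor_quot (S m) n x - INR n * taylor_quot m (S n) x)
    (at_right 0) (Rbar_locally p_infty) 0.
Proof.
intros Hn Hpar.
assert (H0 := coeff_sech_tanh_parity m n Hpar).
replace 0 with (0 - 0) at 2 by ring.
apply is_RInt_gen_primitive with (taylor_quot m n).
- intros a b Hab.
  apply (is_RInt_derive (taylor_quot m n)); intros x Hx;
    rewrite Rmin_left, Rmax_right in Hx by lra.
  + apply is_derive_taylor_quot; [easy|lra].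
  + assert (Hx0 : x <> 0) by lra.
    apply (continuous_minus (fun x => INR m * taylor_quot (pred m) n x
      - INR (S m) * taylor_quot (S m) n x) (fun x => INR n * taylor_quot m (S n) x)).
    * apply (continuous_minus (fun x => INR m * taylor_quot (pred m) n x)
        (fun x => INR (S m) * taylor_quot (S m) n x));
      apply (continuous_scal_r (V := R_NormedModule) _ (taylor_quot _ n));
      now apply continuous_taylor_quot.
    * apply (continuous_scal_r (V := R_NormedModule) _ (taylor_quot m (S n))).
      now apply continuous_taylor_quot.
- rewrite <- H0 at 2.
  apply (trunc_lim_0 _ _ n (sech_tanh_expansion m)).
- now apply taylor_quot_lim_p_infty.
Qed.

(** The factor [INR m] stays inside the first integrand: at [m = 0] the hypothesis then concerns the
    zero function, and nothing is asked of [taylor_quot 0 n] with [n] odd. *)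
Lemma taylor_quot_integral_step (m n : nat) (l1 l2 : R) :
  (1 <= n)%nat -> Nat.Odd (n + m) ->
  is_RInt_gen (fun x => INR m * taylor_quot (pred m) n x)
    (at_right 0) (Rbar_locally p_infty) l1 ->
  is_RInt_gen (taylor_quot m (S n)) (at_right 0) (Rbar_locally p_infty) l2 ->
  is_RInt_gen (taylor_quot (S m) n) (at_right 0) (Rbar_locally p_infty)
    (/ INR (S m) * (l1 - INR n * l2)).
Proof.
intros Hn Hpar H1 H2.
assert (H3 := taylor_quot_by_parts m n Hn Hpar).
assert (H := is_RInt_gen_scal _ (/ INR (S m)) _
  (is_RInt_gen_plus _ _ _ _ H1 (is_RInt_gen_plus _ _ _ _
    (is_RInt_gen_scal _ (- INR n) _ H2) (is_RInt_gen_scal _ (-1) _ H3)))).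
replace (/ INR (S m) * (l1 - INR n * l2)) with
  (/ INR (S m) * (l1 + (- INR n * l2 + -1 * 0))) by ring.
revert H; apply is_RInt_gen_ext, filter_forall; intros ab x _.
unfold scal, plus; cbn -[INR]; unfold mult; cbn -[INR]; eqR.
field; apply not_0_INR; lia.
Qed.

(** * The integrals for m = 0 *)

Lemma filterlim_uniform {F : (R -> Prop) -> Prop} {FF : Filter F}
  (f : nat -> R -> R) (g : R -> R) (l h : nat -> R) (L : R) :
  is_lim_seq h 0 ->
  (forall N, F (fun x => Rabs (f N x - g x) <= h N)) ->
  (forall N, filterlim (f N) F (locally (l N))) ->
  (forall N, Rabs (l N - L) <= h N) ->
  filterlim g F (locally L).
Proof.
intros Hh Hu Hf Hl; apply filterlim_locally; intros e.
assert (He3 : 0 < e / 3) by (generalize (cond_pos e); lra).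
apply is_lim_seq_spec in Hh.
destruct (Hh (mkposreal _ He3)) as [N HN].
specialize (HN N (le_n N)); simpl in HN; rewrite Rminus_0_r in HN.
apply Rabs_lt_between in HN.
assert (Hf' := proj1 (filterlim_locally (f N) (l N)) (Hf N) (mkposreal _ He3)).
generalize (filter_and _ _ Hf' (Hu N)); apply filter_imp; intros x [H1 H2].
change (Rabs (f N x - l N) < e / 3) in H1.
change (Rabs (g x - L) < e).
replace (g x - L) with (- (f N x - g x) + (f N x - l N) + (l N - L)) by ring.
apply Rle_lt_trans with (1 := Rabs_triang _ _).
assert (H3 := Rabs_triang (- (f N x - g x)) (f N x - l N)).
rewrite Rabs_Ropp in H3; specialize (Hl N); lra.
Qed.

Lemma filterlim_sum_f_R0 {F : (R -> Prop) -> Prop} {FF : Filter F}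
  (f : nat -> R -> R) (l : nat -> R) (N : nat) :
  (forall k, filterlim (f k) F (locally (l k))) ->
  filterlim (fun x => sum_f_R0 (fun k => f k x) N) F (locally (sum_f_R0 l N)).
Proof.
intros H; induction N as [|N IH]; [apply H|].
apply (filterlim_comp_2 (G := locally (sum_f_R0 l N)) (H := locally (l (S N)))
  (fun x => sum_f_R0 (fun k => f k x) N) (f (S N)) Rplus); [exact IH|apply H|].
apply (filterlim_plus (sum_f_R0 l N) (l (S N))).
Qed.

Lemma atan_lim_p_infty : filterlim atan (Rbar_locally p_infty) (locally (PI / 2)).
Proof.
apply filterlim_ext_loc with (fun x => PI / 2 - atan (/ x)).
- exists 0; intros x Hx; rewrite atan_inv by easy; ring.
- change (is_lim (fun x => PI / 2 - atan (/ x)) p_infty (PI / 2)).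
  replace (Finite (PI / 2)) with (Finite (PI / 2 - 0)) by (f_equal; ring).
  apply is_lim_minus'; [apply is_lim_const|].
  replace (Finite 0) with (Finite (atan 0)) by now rewrite atan_0.
  apply (is_lim_comp_continuous (fun x => / x) atan).
  + apply (is_lim_inv (fun x => x) p_infty p_infty); [apply is_lim_id|easy].
  + apply (ex_derive_continuous atan); eexists; apply is_derive_atan.
Qed.

(** The primitive of [sech_term] that vanishes at [x = 0]; with a = [pole k] it tends to PI / a^(2p)
    at infinity. *)
Definition sech_term_primitive (p : nat) (x : R) (k : nat) : R :=
  2 * / pole k ^ (2 * p) * atan (x / pole k).

Lemma is_derive_sech_term_primitive (p k : nat) (x : R) :
  is_derive (fun x => sech_term_primitive p x k) x (sech_term p x k).
Proof.
assert (Hk := pole_pos k); assert (0 < pole k ^ (2 * p)) by now apply pow_lt.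
unfold sech_term_primitive, sech_term.
set (q := pole k ^ (2 * p)) in *; clearbody q.
evar_last.
- apply (is_derive_scal (fun x => atan (x / pole k))).
  apply (is_derive_comp atan (fun x => x / pole k)).
  + apply is_derive_atan.
  + auto_derive; [easy | reflexivity].
- unfold scal; simpl; unfold mult; simpl; eqR.
  assert (pole k * pole k + x * x <> 0) by nra.
  unfold Rsqr; field; repeat split; nra.
Qed.

Lemma continuous_sech_term (p k : nat) (x : R) :
  continuous (fun x => sech_term p x k) x.
Proof.
apply (ex_derive_continuous (fun x => sech_term p x k)); unfold sech_term.
assert (Hk := pole_pos k); assert (0 < pole k ^ (2 * p)) by now apply pow_lt.
set (q := pole k ^ (2 * p)) in *; clearbody q; auto_derive.
apply Rgt_not_eq, Rmult_lt_0_compat; nra.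
Qed.

Lemma atan_nonneg (x : R) : 0 <= x -> 0 <= atan x < PI / 2.
Proof.
intros Hx; assert (H := atan_bound x); split; [|lra].
destruct Hx as [Hx|<-]; [|rewrite atan_0; lra].
rewrite <- atan_0; now apply Rlt_le, atan_increasing.
Qed.

Lemma pole_pow_lim (p : nat) (c : R) : (1 <= p)%nat ->
  is_lim_seq (fun k => c * / pole k ^ (2 * p)) 0.
Proof.
intros Hp; replace (2 * p)%nat with (S (2 * p - 1)) by lia.
apply inv_pole_pow_lim.
Qed.

Lemma pole_pow_le (p k : nat) : / pole (S k) ^ p <= / pole k ^ p.
Proof.
assert (Hk := pole_pos k); assert (Hlt := pole_lt k).
apply Rinv_le_contravar; [now apply pow_lt | apply pow_incr; lra].
Qed.

(** The bound PI / a^(2p) does not involve x and tends to 0 for [p >= 1], so the series of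
    primitives converges uniformly on x >= 0. *)
Lemma sech_term_primitive_alternating (p : nat) (x : R) :
  (1 <= p)%nat -> 0 <= x ->
  Un_decreasing (sech_term_primitive p x) /\
  (forall k, 0 <= sech_term_primitive p x k <= PI * / pole k ^ (2 * p)) /\
  is_lim_seq (sech_term_primitive p x) 0.
Proof.
intros Hp Hx.
assert (Hq : forall k, 0 < / pole k ^ (2 * p))
  by (intros k; apply Rinv_0_lt_compat, pow_lt, pole_pos).
assert (Hat : forall k, 0 <= atan (x / pole k) < PI / 2).
{ intros k; apply atan_nonneg, Rdiv_le_0_compat; [easy|apply pole_pos]. }
assert (Hb : forall k, 0 <= sech_term_primitive p x k <= PI * / pole k ^ (2 * p)).
{ intros k; unfold sech_term_primitive; specialize (Hq k); specialize (Hat k).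
  split; nra. }
split; [|split; [exact Hb|]].
- intros k; unfold sech_term_primitive.
  assert (Hk := pole_pos k); assert (Hk' := pole_pos (S k)); assert (Hlt := pole_lt k).
  assert (H := pole_pow_le (2 * p) k); assert (Hqk := Hq (S k)).
  apply Rmult_le_compat; [lra | apply Hat | lra |].
  assert (Hle : x / pole (S k) <= x / pole k).
  { apply Rmult_le_compat_l; [easy|]; apply Rinv_le_contravar; lra. }
  destruct Hle as [Hle| ->]; [now apply Rlt_le, atan_increasing | apply Rle_refl].
- apply is_lim_seq_le_le with (2 := is_lim_seq_const 0)
    (3 := pole_pow_lim p PI Hp); exact Hb.
Qed.

Lemma taylor_quot_sech_term (p N : nat) (x : R) : (1 <= p)%nat -> 0 < x ->
  Rabs ((-1) ^ p * sech_sum p N x - taylor_quot 0 (2 * p) x) <= sech_term p 0 N.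
Proof.
intros Hp Hx; destruct p as [|p]; [lia|].
destruct (alternating_series_bound (sech_term (S p) x)) as [l [Hl Hb]];
  [apply sech_term_decreasing | apply sech_term_lim|].
assert (E : taylor_quot 0 (2 * S p) x = (-1) ^ S p * l).
{ assert (H1 := is_lim_seq_unique _ _ (taylor_quot_sech_sum (S p) x Hx)).
  assert (H2 := is_lim_seq_unique _ _ (is_lim_seq_scal_l _ ((-1) ^ S p) _ Hl)).
  unfold sech_sum in H1; rewrite H1 in H2; now injection H2. }
rewrite E, <- Rmult_minus_distr_l, Rabs_mult, pow_1_abs, Rmult_1_l.
apply Rle_trans with (1 := Hb N); apply sech_term_le.
Qed.

(** With a = (2 k + 1) PI / 2, the term PI / a^(2p) is 2^(2p) / PI^(2p-1) times 1 / (2 k +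
    1)^(2p). *)
Lemma pole_series (p : nat) : (1 <= p)%nat ->
  is_lim_seq (sum_f_R0 (tg_alt (fun k => PI * / pole k ^ (2 * p))))
    (2 ^ (2 * p) * (dirichlet_beta (INR (2 * p)) / PI ^ (2 * p - 1))).
Proof.
intros Hp; assert (HPI := PI_RGT_0).
destruct (alternating_series_bound (fun k => PI * / pole k ^ (2 * p)))
  as [l [Hl _]].
- intros k; apply Rmult_le_compat_l; [lra|]; apply pole_pow_le.
- now apply pole_pow_lim.
- replace (2 ^ (2 * p) * _) with l; [exact Hl|].
  set (c := 2 ^ (2 * p) / PI ^ (2 * p - 1)).
  assert (Hc : c <> 0).
  { apply Rgt_not_eq, Rdiv_lt_0_compat; apply pow_lt; lra. }
  replace (2 ^ (2 * p) * (dirichlet_beta (INR (2 * p)) / PI ^ (2 * p - 1)))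
    with (c * dirichlet_beta (INR (2 * p))) by (unfold c, Rdiv; ring).
  unfold dirichlet_beta.
  rewrite (is_series_unique _ (/ c * l)); [field; easy|].
  apply is_series_Reals, is_lim_seq_Reals.
  apply is_lim_seq_ext with
    (fun N => / c * sum_f_R0 (tg_alt (fun k => PI * / pole k ^ (2 * p))) N).
  + intros N; rewrite scal_sum; apply sum_eq; intros k _.
    assert (Hk : 0 < 2 * INR k + 1) by (generalize (pos_INR k); lra).
    rewrite Rpower_pow by easy; unfold tg_alt, c, pole.
    replace ((INR k + / 2) * PI) with ((2 * INR k + 1) * PI * / 2) by field.
    rewrite !Rpow_mult_distr, pow_inv.
    replace (PI ^ (2 * p)) with (PI * PI ^ (2 * p - 1))
      by (rewrite tech_pow_Rmult; f_equal; lia).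
    assert (0 < PI ^ (2 * p - 1)) by now apply pow_lt.
    assert (0 < (2 * INR k + 1) ^ (2 * p)) by now apply pow_lt.
    assert (0 < 2 ^ (2 * p)) by (apply pow_lt; lra).
    set (q := PI ^ (2 * p - 1)) in *; set (r := (2 * INR k + 1) ^ (2 * p)) in *.
    set (t := 2 ^ (2 * p)) in *; clearbody q r t.
    field; repeat split; lra.
  + exact (is_lim_seq_scal_l _ (/ c) _ Hl).
Qed.

(** The primitive is, up to sign, the sum A of the series of primitives. Uniform convergence serves
    three times: on [a, b] to integrate termwise, and at 0 and at infinity to exchange the limit
    with the sum. *)
Lemma taylor_quot_integral_sech (p : nat) : (1 <= p)%nat ->
  is_RInt_gen (taylor_quot 0 (2 * p)) (at_right 0) (Rbar_locally p_infty)
    ((-1) ^ p * (2 ^ (2 * p) * (dirichlet_beta (INR (2 * p)) / PI ^ (2 * p - 1)))).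
Proof.
intros Hp; assert (HPI := PI_RGT_0).
set (B := 2 ^ (2 * p) * _).
set (V := fun N x => sum_f_R0 (tg_alt (sech_term_primitive p x)) N).
assert (HA : exists A : R -> R, forall x, 0 <= x ->
  is_lim_seq (fun N => V N x) (A x) /\
  forall N, Rabs (V N x - A x) <= PI * / pole N ^ (2 * p)).
{ exists (fun x => real (Lim_seq (fun N => V N x))); intros x Hx.
  destruct (sech_term_primitive_alternating p x Hp Hx) as [H1 [H2 H3]].
  destruct (alternating_series_bound _ H1 H3) as [l [Hl Hb]].
  assert (E : Lim_seq (fun N => V N x) = l) by exact (is_lim_seq_unique _ _ Hl).
  rewrite E; split; [exact Hl|].
  intros N; apply Rle_trans with (1 := Hb N), H2. }
destruct HA as [A HA].
assert (HV : forall N x, is_derive (V N) x (sech_sum p N x)).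
{ intros N x; apply (is_derive_sum_f_R0
    (fun k x => tg_alt (sech_term_primitive p x) k)
    (fun k x => tg_alt (sech_term p x) k)).
  intros k; apply (is_derive_scal (fun x => sech_term_primitive p x k)).
  apply is_derive_sech_term_primitive. }
replace ((-1) ^ p * B) with ((-1) ^ p * B - (-1) ^ p * 0) by ring.
apply is_RInt_gen_primitive with (fun x => (-1) ^ p * A x).
- intros a b Hab.
  assert (Hint : ex_RInt (taylor_quot 0 (2 * p)) a b).
  { apply (ex_RInt_continuous (V := R_CompleteNormedModule)).
    intros x Hx; rewrite Rmin_left, Rmax_right in Hx by lra.
    apply continuous_taylor_quot; lra. }
  destruct Hint as [I HI].
  replace ((-1) ^ p * A b - (-1) ^ p * A a) with I; [exact HI|].
  (* The integrals of the partial sums over [a, b] have two limits, which must agree: one by the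
     definition of A, one by uniform approximation of the integrand. *)
  assert (H1 : is_lim_seq (fun N => (-1) ^ p * (V N b - V N a))
    ((-1) ^ p * (A b - A a))).
  { apply (is_lim_seq_scal_l _ ((-1) ^ p) (Finite (A b - A a))).
    apply is_lim_seq_minus'; apply HA; lra. }
  assert (H2 : is_lim_seq (fun N => (-1) ^ p * (V N b - V N a)) I).
  { apply is_lim_seq_ext with (fun N => ((-1) ^ p * (V N b - V N a) - I) + I);
      [intros N; ring|].
    replace (Finite I) with (Finite (0 + I)) by (f_equal; ring).
    apply is_lim_seq_plus'; [|apply is_lim_seq_const].
    apply is_lim_seq_abs_0.
    apply is_lim_seq_le_le with (fun _ => 0) (fun N => (b - a) * sech_term p 0 N).
    - intros N; split; [apply Rabs_pos|].
      apply (norm_RInt_le_const (V := R_NormedModule)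
        (fun x => (-1) ^ p * sech_sum p N x - taylor_quot 0 (2 * p) x) a b).
      + lra.
      + intros x Hx; apply taylor_quot_sech_term; [easy|lra].
      + apply (is_RInt_minus (V := R_NormedModule)
          (fun x => (-1) ^ p * sech_sum p N x)); [|exact HI].
        apply (is_RInt_scal (V := R_NormedModule) (sech_sum p N)).
        apply (is_RInt_derive (V N)); intros x _; [apply HV|].
        unfold sech_sum; apply (filterlim_sum_f_R0
          (fun k x => tg_alt (sech_term p x) k) (tg_alt (sech_term p x))).
        intros k; apply (continuous_scal_r (V := R_NormedModule) ((-1) ^ k)
          (fun x => sech_term p x k)); apply continuous_sech_term.
    - apply is_lim_seq_const.
    - replace (Finite 0) with (Rbar_mult (b - a) 0) by (simpl; f_equal; ring).
      apply is_lim_seq_scal_l, sech_term_lim. }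
  apply is_lim_seq_unique in H1; apply is_lim_seq_unique in H2.
  rewrite H1 in H2; injection H2 as H2; lra.
- apply (filterlim_comp _ _ _ A (Rmult ((-1) ^ p)) _ (locally 0));
    [|apply (filterlim_scal_r (V := R_NormedModule) ((-1) ^ p) 0)].
  apply (filterlim_uniform V A (fun _ => 0) (fun N => PI * / pole N ^ (2 * p))).
  + now apply pole_pow_lim.
  + intros N; exists (mkposreal 1 Rlt_0_1); intros x _ Hx; apply HA; lra.
  + intros N; apply (filterlim_filter_le_1 (F := locally 0));
      [apply filter_le_within; apply locally_filter|].
    replace 0 with (V N 0) at 2.
    * apply (ex_derive_continuous (V N)); eexists; apply HV.
    * apply sum_eq_R0; intros k _; unfold tg_alt, sech_term_primitive.
      rewrite Rdiv_0_l, atan_0; ring.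
  + intros N; rewrite Rminus_0_r, Rabs_R0; apply Rlt_le, Rmult_lt_0_compat;
      [easy|]; apply Rinv_0_lt_compat, pow_lt, pole_pos.
- apply (filterlim_comp _ _ _ A (Rmult ((-1) ^ p)) _ (locally B));
    [|apply (filterlim_scal_r (V := R_NormedModule) ((-1) ^ p) B)].
  assert (Hdec : Un_decreasing (fun k => PI * / pole k ^ (2 * p))).
  { intros k; apply Rmult_le_compat_l; [lra|]; apply pole_pow_le. }
  apply (filterlim_uniform V A
    (sum_f_R0 (tg_alt (fun k => PI * / pole k ^ (2 * p))))
    (fun N => PI * / pole N ^ (2 * p))).
  + now apply pole_pow_lim.
  + intros N; exists 0; intros x Hx; apply HA; lra.
  + intros N; apply (filterlim_sum_f_R0
      (fun k x => tg_alt (sech_term_primitive p x) k)); intros k.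
    unfold tg_alt, sech_term_primitive.
    apply (is_lim_scal_l _ _ p_infty (Finite (PI * / pole k ^ (2 * p)))).
    replace (PI * / pole k ^ (2 * p)) with (2 * / pole k ^ (2 * p) * (PI / 2))
      by (set (q := / pole k ^ (2 * p)); field).
    apply (is_lim_scal_l _ _ p_infty (Finite (PI / 2))).
    apply (filterlim_comp _ _ _ (fun x => x / pole k) atan _ (Rbar_locally p_infty));
      [|apply atan_lim_p_infty].
    assert (Hk := pole_pos k).
    intros P [M HM]; exists (M * pole k); intros x Hx; apply HM.
    apply Rmult_lt_reg_r with (pole k); [easy|].
    unfold Rdiv; rewrite Rmult_assoc, Rinv_l; lra.
  + intros N; apply (Alt_first_term_bound _ B N N Hdec); [| |easy];
      apply is_lim_seq_Reals; [now apply pole_pow_lim | now apply pole_series].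
Qed.

(** * The recursion for the closed form *)

(* Equals [Binomial.C (2 * p - 1) j] when [j <= 2 * p - 1]; unlike
   [Binomial.C], it vanishes for larger [j]. *)
Fixpoint odd_binomial (p j : nat) : R :=
  match j with
  | O => 1
  | S j => odd_binomial p j * (INR (2 * p) - INR (S j)) / INR (S j)
  end.

Lemma odd_binomial_C (p j : nat) : (j < 2 * p)%nat ->
  odd_binomial p j = Binomial.C (2 * p - 1) j.
Proof.
induction j as [|j IH]; intros Hj.
- unfold Binomial.C; rewrite Nat.sub_0_r; simpl fact; simpl INR.
  cbn [odd_binomial]; field; apply INR_fact_neq_0.
- cbn [odd_binomial]; rewrite IH by lia; unfold Binomial.C.
  replace (2 * p - 1 - j)%nat with (S (2 * p - 1 - S j)) by lia.
  replace (INR (2 * p) - INR (S j)) with (INR (S (2 * p - 1 - S j)))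
    by (rewrite <- minus_INR by lia; f_equal; lia).
  rewrite (fact_simpl j), (fact_simpl (2 * p - 1 - S j)), !mult_INR.
  field; repeat split; try apply INR_fact_neq_0; apply not_0_INR; lia.
Qed.

(** The product acquires the factor [2 p - 2 p] at index [2 p]. These zeros let the closed form sum
    over all indices from 0, whatever j is. *)
Lemma odd_binomial_0 (p j : nat) : (1 <= p)%nat -> (2 * p <= j)%nat ->
  odd_binomial p j = 0.
Proof.
intros Hp; induction j as [|j IH]; intros Hj; [lia|]; cbn [odd_binomial].
destruct (Nat.eq_dec (2 * p) (S j)) as [->|Hn].
- unfold Rdiv; ring.
- rewrite IH by lia; unfold Rdiv; ring.
Qed.

Definition beta_term (p : nat) : R :=
  2 ^ (2 * p) * (dirichlet_beta (INR (2 * p)) / PI ^ (2 * p - 1)).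

(* The right-hand side of the theorem for [n = j + 1] and [m + n = 2 (k + 1)],
   with the summation index [p = i + 1]. *)
Definition closed_form (m j k : nat) : R :=
  (-1) ^ (k + j) * sum_f_R0 (fun i => beta_term (S i) * odd_binomial (S i) j *
    coeff (2 * k - 2 * i) (csc_cot m)) k.

(** The binomials vanish at all indices but the last, where binomial and coefficient are both 1. *)
Lemma closed_form_0 (k : nat) :
  closed_form 0 (2 * k + 1) k = (-1) ^ S k * beta_term (S k).
Proof.
unfold closed_form.
replace (sum_f_R0 _ k) with (beta_term (S k)).
- replace (k + (2 * k + 1))%nat with (2 * k + S k)%nat by lia.
  rewrite pow_add, pow_1_even; ring.
- assert (E : beta_term (S k) * odd_binomial (S k) (2 * k + 1) *
    coeff (2 * k - 2 * k) (csc_cot 0) = beta_term (S k)).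
  { rewrite Nat.sub_diag, coeff_csc_cot_0, odd_binomial_C by lia.
    replace (2 * S k - 1)%nat with (2 * k + 1)%nat by lia.
    unfold Binomial.C; rewrite Nat.sub_diag; simpl (fact 0); simpl (INR 1).
    field; apply INR_fact_neq_0. }
  destruct k as [|k]; cbn [sum_f_R0]; [now rewrite E|].
  rewrite sum_eq_R0; [rewrite E; ring|].
  intros i Hi; rewrite odd_binomial_0 by lia; ring.
Qed.

(** At exponent r = 2 k - 2 i the factor m + 1 - r of [coeff_csc_cot] is 2 (i + 1) - (j + 1), which
    turns the binomial at j into j + 1 times the one at j + 1. The other term has its exponent
    lowered by 2, which is the closed form at k - 1. *)
Lemma closed_form_step (m j k : nat) : (m + j = 2 * k)%nat ->
  INR (S m) * closed_form (S m) j k =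
  INR m * closed_form (pred m) j (pred k) - INR (S j) * closed_form m (S j) k.
Proof.
intros Hmj; unfold closed_form.
set (T := fun i => beta_term (S i) * odd_binomial (S i) j *
  match (2 * k - 2 * i)%nat with S (S r) => coeff r (csc_cot (pred m)) | _ => 0 end).
assert (E1 : INR (S m) * sum_f_R0 (fun i => beta_term (S i) *
    odd_binomial (S i) j * coeff (2 * k - 2 * i) (csc_cot (S m))) k =
  INR (S j) * sum_f_R0 (fun i => beta_term (S i) *
    odd_binomial (S i) (S j) * coeff (2 * k - 2 * i) (csc_cot m)) k
  - INR m * sum_f_R0 T k).
{ rewrite !scal_sum, <- minus_sum; apply sum_eq; intros i Hi.
  rewrite Rmult_assoc, (Rmult_comm _ (INR (S m))), coeff_csc_cot.
  cbn [odd_binomial]; unfold T.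
  assert (Hw : INR (S m) - INR (2 * k - 2 * i) = INR (2 * S i) - INR (S j)).
  { rewrite minus_INR by lia.
    assert (H := f_equal INR Hmj); rewrite !mult_INR, plus_INR in H.
    rewrite !mult_INR, !S_INR; simpl INR in *; lra. }
  rewrite Hw; field; apply not_0_INR; lia. }
assert (E2 : INR m * (-1) ^ (pred k + j) * sum_f_R0 (fun i => beta_term (S i) *
    odd_binomial (S i) j * coeff (2 * pred k - 2 * i) (csc_cot (pred m))) (pred k)
  = - INR m * (-1) ^ (k + j) * sum_f_R0 T k).
(* For [k = 0] also [m = 0], and the factor [INR m] removes the truncated [pred k]. *)
{ destruct k as [|k].
  - replace m with O by lia; simpl INR; ring.
  - cbn [pred sum_f_R0].
    replace (T (S k)) with 0 by (unfold T; rewrite Nat.sub_diag; ring).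
    rewrite (sum_eq _ T k).
    + simpl; ring.
    + intros i Hi; unfold T.
      now replace (2 * S k - 2 * i)%nat with (S (S (2 * k - 2 * i))) by lia. }
rewrite <- (Rmult_assoc (INR m)), E2.
replace (k + S j)%nat with (S (k + j)) by lia.
replace (INR (S m) * _) with ((-1) ^ (k + j) * (INR (S m) *
  sum_f_R0 (fun i => beta_term (S i) * odd_binomial (S i) j *
    coeff (2 * k - 2 * i) (csc_cot (S m))) k)) by ring.
rewrite E1; simpl; ring.
Qed.

(** Strong induction on m with j and k free: a step lowers m by 1 while raising j, or lowers m by 2
    and k by 1. *)
Lemma taylor_quot_integral (m j k : nat) : (m + j = 2 * k + 1)%nat ->
  is_RInt_gen (taylor_quot m (S j)) (at_right 0) (Rbar_locally p_infty)
    (closed_form m j k).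
Proof.
revert j k; induction m as [m IH] using (well_founded_induction lt_wf).
intros j k Hmj; destruct m as [|m].
- replace j with (2 * k + 1)%nat by lia; rewrite closed_form_0.
  replace (S (2 * k + 1)) with (2 * S k)%nat by lia.
  apply taylor_quot_integral_sech; lia.
- replace (closed_form (S m) j k) with (/ INR (S m) *
    (INR m * closed_form (pred m) j (pred k) - INR (S j) * closed_form m (S j) k)).
  + assert (H2 := IH m ltac:(lia) (S j) k ltac:(lia)).
    apply taylor_quot_integral_step; [lia | exists k; lia | | exact H2].
    destruct m as [|m].
    (* The integrand is the zero function, obtained as 0 times the integrand of [H2]. *)
    * replace (INR 0 * _) with (0 * closed_form 0 (S j) k) by (simpl; ring).
      generalize (is_RInt_gen_scal _ 0 _ H2).
      apply is_RInt_gen_ext, filter_forall; intros ab x _.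
      unfold scal; simpl; unfold mult; simpl; eqR; ring.
    * apply (is_RInt_gen_scal (taylor_quot m (S j)) (INR (S m))).
      apply IH; lia.
  + rewrite <- closed_form_step by lia; field; apply not_0_INR; lia.
Qed.

Theorem proposition1p4 (m n : nat)
  (hn : (1 <= n)%nat) (hmn : (n <= m)%nat)
  (hpar : ((m + n) mod 2 = 0)%nat) :
  is_RInt_gen (fun x : R => tanh x ^ m / (x ^ n * cosh x))
    (at_right 0) (Rbar_locally p_infty)
    ((-1) ^ ((m - n) / 2) *
     sum_n_m
       (fun p : nat =>
          2 ^ (2 * p) * Binomial.C (2 * p - 1) (n - 1) *
          (dirichlet_beta (INR (2 * p)) / PI ^ (2 * p - 1)) *
          coeff (m + n - 2 * p)
            (fun u : R => u_over_sin u * u_cot u ^ m))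
       ((n + 1) / 2) ((m + n) / 2)).
Proof.
destruct n as [|j]; [lia|].
assert (Hk : exists k, (m + j = 2 * k + 1)%nat).
{ apply Nat.Div0.mod_divides in hpar; destruct hpar as [q Hq].
  exists (q - 1)%nat; lia. }
destruct Hk as [k Hk].
replace ((m + S j) / 2)%nat with (S k)
  by (apply (Nat.div_unique _ _ _ 0); lia).
replace ((m - S j) / 2)%nat with (k - j)%nat
  by (apply (Nat.div_unique _ _ _ 0); lia).
replace ((S j + 1) / 2)%nat with (S (j / 2))
  by (replace (S j + 1)%nat with (j + 1 * 2)%nat by lia;
      rewrite Nat.div_add; lia).
replace (S j - 1)%nat with j by lia.
assert (Hj := Nat.div_mod_eq j 2); assert (Hj2 := Nat.mod_upper_bound j 2 ltac:(lia)).
set (g := fun i => beta_term (S i) * odd_binomial (S i) j *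
    coeff (2 * k - 2 * i) (csc_cot m)).
match goal with |- is_RInt_gen _ _ _ (_ * ?s) =>
  replace s with (sum_f_R0 g k) end.
(* The subtraction is exact: [m >= j + 1] forces [j <= k]. *)
- replace ((-1) ^ (k - j)) with ((-1) ^ (k + j)).
  + generalize (taylor_quot_integral m j k Hk).
    apply is_RInt_gen_ext, filter_forall; intros ab x _.
    unfold taylor_quot; rewrite trunc_0 by (intros; apply coeff_sech_tanh_low; lia).
    unfold sech_tanh, Rdiv; rewrite Rinv_mult; eqR; ring.
  + replace (k + j)%nat with (2 * j + (k - j))%nat by lia.
    rewrite pow_add, pow_1_even; ring.
- rewrite <- sum_n_Reals; unfold sum_n.
  (* For i < j / 2 one has 2 (i + 1) <= j, so the binomial vanishes; this accounts for the lower
     limit of the sum. *)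
  transitivity (sum_n_m g (j / 2) k).
  + destruct (Nat.eq_dec (j / 2) 0) as [->|Hn]; [easy|].
    rewrite (sum_n_m_Chasles g 0 (j / 2 - 1) k) by lia.
    replace (S (j / 2 - 1)) with (j / 2)%nat by lia.
    rewrite (sum_n_m_ext_loc g (fun _ => zero) 0 (j / 2 - 1)), sum_n_m_const_zero.
    * apply Rplus_0_l.
    * intros i Hi; unfold g; rewrite odd_binomial_0 by lia.
      unfold zero; simpl; eqR; ring.
  + rewrite <- sum_n_m_S; apply sum_n_m_ext_loc; intros i Hi.
    unfold g, beta_term; rewrite odd_binomial_C by lia.
    replace (m + S j - 2 * S i)%nat with (2 * k - 2 * i)%nat by lia.
    unfold csc_cot; eqR; ring.
Qed.
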